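(* Let $f:\mathbb{R}^n\to\mathbb{R}$ be convex and $L$-smooth ($L>0$), attaining its minimum $f^*>-\infty$ at some $x^*\in\mathbb{R}^n$, let $x_0\in\mathbb{R}^n$ and $\sigma>0$. For $\varepsilon>0$ put $$h^\sigma(\varepsilon):=\exp\left(\sigma^2\zeta(1+\varepsilon)\right)\left(\zeta(1+\varepsilon)\right)^2,$$ where $\zeta$ is the Riemann zeta function. Then there exists a constant $C_0$, depending only on the problem parameters ($f$, $L$, $\sigma$) and the starting point $x_0$ (in particular not on $\varepsilon$, $\beta$, $k$ or $\tau$), such that for every $\varepsilon\in(0,0.5)$ there is a deterministic positive step-size sequence $\{\eta_k\}$, depending only on $\varepsilon$ and the problem parameters, for which the following holds. Let $\{x_k\}$ be generated by the SGDM recursion $$x_{k+1}=x_k+\frac{k}{k+2}(x_k-x_{k-1})-\frac{2\sqrt{\eta_k}}{(k+2)\sqrt{k}}\,g(x_k,\xi_k),\quad k\in\mathbb{N}_+,\qquad x_1=x_0,$$ where the stochastic gradients satisfy, for every $k\ge 1$ (with $\mathcal{F}_k=\sigma(\xi_1,\dots,\xi_k)$): (i) $\mathbb{E}[g(x_k,\xi_k)\mid\mathcal{F}_{k-1}]=\nabla f(x_k)$; (ii) $\mathbb{E}[\|g(x_k,\xi_k)\|^2\mid\mathcal{F}_{k-1}]\le\|\nabla f(x_k)\|^2+\sigma^2$; (iii) $\mathbb{E}\left[\exp\left(\frac{\|g(x_k,\xi_k)-\nabla f(x_k)\|^2}{\sigma^2}\right)\Big|\,\mathcal{F}_{k-1}\right]\le\exp(1)$.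 Then for every $\beta\in(0,0.5)$, $$\mathbb{P}\left(f(x_k)-f^*\le C_0\cdot\frac{h^\sigma(\varepsilon)\left(1+\log\frac1\beta\right)\log^{\frac{1+\varepsilon}{2}}(k+2)}{\sqrt{k+1}}\ \text{ for all }k\in\mathbb{N}_+\right)\ge 1-2\beta,$$ and for every $\beta\in(0,0.5)$ and every stopping time $\tau$, $$\mathbb{P}\left(f(x_\tau)-f^*\le C_0\cdot\frac{h^\sigma(\varepsilon)\left(1+\log\frac1\beta\right)\log^{\frac{1+\varepsilon}{2}}(\tau+2)}{\sqrt{\tau+1}}\right)\ge 1-2\beta.$$
   Context: $\mathbb{N}_+=\{1,2,\dots\}$; $\log$ is the natural logarithm and $\log^{p}(x)=(\log x)^p$; $\|\cdot\|$ is the Euclidean norm. $L$-smooth means $f$ is differentiable and $\|\nabla f(x)-\nabla f(y)\|\le L\|x-y\|$ for all $x,y\in\mathbb{R}^n$. The $\xi_k$ are random elements on a common probability space, $g(\cdot,\cdot)$ is a measurable $\mathbb{R}^n$-valued map, $g(x_k,\xi_k)$ is the stochastic gradient at $x_k$, the starting point $x_0$ is deterministic, and $\mathcal{F}_k=\sigma(\xi_1,\dots,\xi_k)$ with $\mathcal{F}_0$ trivial (so $x_k$ is $\mathcal{F}_{k-1}$-measurable for $k\ge1$). A stopping time $\tau$ is an $\mathbb{N}_+$-valued random variable that is a stopping time with respect to the filtration generated by the iterates $\{x_k\}$, i.e. $\{\tau\le k\}\in\sigma(x_0,\dots,x_k)$ for every $k$. *)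

(* Defs.v *)
From HB Require Import structures.
From mathcomp Require Import all_boot all_order all_algebra.
From mathcomp Require Import all_classical all_reals all_analysis measurable_realfun.

Set Implicit Arguments.
Unset Strict Implicit.
Unset Printing Implicit Defensive.

Import Order.TTheory GRing.Theory Num.Theory.
Import numFieldNormedType.Exports.

Local Open Scope classical_set_scope.
Local Open Scope ring_scope.

Section euclidean_space.
Context {R : realType} {n : nat}.

(* The library norm on ['rV[R]_n] is the sup norm; both norms induce the same
   topology, so [differentiable] and [open] need no change. *)
Definition enorm (x : 'rV[R]_n) : R := Num.sqrt (\sum_i x ord0 i ^+ 2).

Definition gradient (f : 'rV[R]_n -> R) (x : 'rV[R]_n) : 'rV[R]_n :=
  \row_i 'D_(delta_mx ord0 i) f x.

Definition lsmooth (L : R) (f : 'rV[R]_n -> R) : Prop :=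
  (forall x, differentiable f x) /\
  (forall x y, enorm (gradient f x - gradient f y) <= L * enorm (x - y)).

End euclidean_space.

(* R^n with its Borel sigma-algebra; convertible to ['rV[R]_n]. *)
Definition borel_rV (R : realType) (n : nat) :=
  g_sigma_algebraType (@open 'rV[R]_n).

(* Used only for s > 1, where the series converges. *)
Definition zeta (R : realType) (s : R) : R :=
  limn (series (fun m : nat => m.+1%:R `^ (- s))).

Definition h_sigma (R : realType) (sigma eps : R) : R :=
  expR (sigma ^+ 2 * zeta (1 + eps)) * zeta (1 + eps) ^+ 2.

Definition sgdm_rate (R : realType) (sigma eps beta : R) (k : nat) : R :=
  h_sigma sigma eps * (1 + ln (1 / beta)) *
    ln (k + 2)%:R `^ ((1 + eps) / 2) / Num.sqrt (k + 1)%:R.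

Section probability_notions.
Context {R : realType} {d : measure_display} {T : measurableType d}.

(* A generating family (not yet a sigma-algebra) of sigma(X_i, i in D). *)
Definition generators (d' : measure_display) (U : measurableType d')
    (X : nat -> T -> U) (D : set nat) : set_system T :=
  \bigcup_(i in D) preimage_set_system setT (X i) measurable.

(* Z is a version of E[X | <<s G>>]. The notion is meaningful, and used, only
   when X is nonnegative (the common value of the integrals may then be +oo) or
   integrable. *)
Definition is_cond_exp (P : probability T R) (G : set_system T)
    (X Z : T -> \bar R) : Prop :=
  measurable_fun [set: g_sigma_algebraType G] (Z : g_sigma_algebraType G -> \bar R) /\
  (forall A, <<s G >> A -> \int[P]_(w in A) X w = \int[P]_(w in A) Z w)%E.

(* E[X | <<s G>>] = Y for vector-valued X, coordinatewise. *)
Definition cond_exp_vec_eq (n : nat) (P : probability T R) (G : set_system T)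
    (X Y : T -> 'rV[R]_n) : Prop :=
  forall i : 'I_n,
    P.-integrable setT (fun w => (X w ord0 i)%:E) /\
    is_cond_exp P G (fun w => (X w ord0 i)%:E) (fun w => (Y w ord0 i)%:E).

(* E[X | <<s G>>] <= Y almost surely, for nonnegative X. Versions always exist
   and are almost surely equal, so it does not matter which one is taken. *)
Definition cond_exp_le (P : probability T R) (G : set_system T)
    (X Y : T -> R) : Prop :=
  exists Z : T -> \bar R,
    is_cond_exp P G (EFin \o X) Z /\ {ae P, forall w, (Z w <= (Y w)%:E)%E}.

(* N_+-valued stopping times of the filtration sigma(x_0, ..., x_k). *)
Definition stopping_time (n : nat) (x : nat -> T -> 'rV[R]_n)
    (tau : T -> nat) : Prop :=
  (forall w, (1 <= tau w)%N) /\
  (forall k : nat,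
    <<s generators (x : nat -> T -> borel_rV R n) [set i | (i <= k)%N] >>
      [set w | (tau w <= k)%N]).

(* The entries [xi 0] and [eta 0] are never used. *)
Definition sgdm_iterates (n : nat) (E : Type) (x0 : 'rV[R]_n) (eta : nat -> R)
    (g : 'rV[R]_n -> E -> 'rV[R]_n) (xi : nat -> T -> E)
    (x : nat -> T -> 'rV[R]_n) : Prop :=
  (forall w, x 0%N w = x0) /\
  (forall w, x 1%N w = x0) /\
  (forall (k : nat) (w : T), (1 <= k)%N ->
    x k.+1 w = x k w + (k%:R / (k + 2)%:R) *: (x k w - x k.-1 w)
      - (2 * Num.sqrt (eta k) / ((k + 2)%:R * Num.sqrt k%:R))
          *: g (x k w) (xi k w)).

End probability_notions.

(* Main.v *)
Require Import Defs.
From HB Require Import structures.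
From mathcomp Require Import all_boot all_order all_algebra.
From mathcomp Require Import all_classical all_reals all_analysis measurable_realfun.
From mathcomp Require Import ring lra zify.

Set Implicit Arguments.
Unset Strict Implicit.
Unset Printing Implicit Defensive.

Import Order.TTheory GRing.Theory Num.Theory.
Import numFieldNormedType.Exports.

Local Open Scope classical_set_scope.
Local Open Scope ring_scope.

(** Put [d k = x k - x k.-1] and [z k = x k + k d k].  The momentum recursion
    says exactly that [z k.+1 = z k - 2 s k g k], where
    [s k = sqrt (eta k / k)] and [g k] is the stochastic gradient at [x k]: the
    method is plain stochastic gradient descent on [z], with gradients taken at
    the running averages [x k] of the points [z i].  Convexity and smoothness of
    [f] then bound the potential

      [V j = |z j.+1 - xstar|^2 + 4 s j (j + 1) (f (x j) - f xstar)]

    by its predecessor plus a term linear in the gradient noise [nu], namely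
    [- 4 s <nu, z - xstar>], plus [8 s^2 |nu|^2] ([lyapunov_step]).

    The linear term is centred but its size grows like [sqrt (V j)], which is
    not bounded in advance.  A potential that weighs [V j] with slowly
    decreasing coefficients corrects itself:

      [exp ((1 - 160 Q j) V j - 16 Q j)], with
      [Q j = sigma^2 (s 1 ^ 2 + ... + s j ^ 2)],

    is a supermartingale on the event that it stays below a given level
    ([exp_potential_supermartingale]), because for sub-Gaussian noise the
    logarithm of the conditional exponential moment of the increment is at most
    a multiple of [sigma^2 s^2 (V j + 1)], and the decrease of the coefficients
    pays for it.  The conditional exponential moment is
    controlled pointwise ([expR_subgaussian]): the exponential of the increment
    is below its linear part, whose conditional mean vanishes, plus an affine
    function of [exp (|nu|^2 / sigma^2)], whose conditional mean is at most
    [exp 1].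

    A maximal inequality for stopped supermartingales
    ([stopped_maximal_inequality]) turns this into: with probability at least
    [1 - beta], for all [j] simultaneously,
    [V j <= 2 (V 0 + 1 + ln (1 / beta))].  Dividing by [4 s j (j + 1)] gives the
    rate for every index at once, hence also at a random index [tau].

    It remains to choose the steps: with
    [eta k = c0^2 / (zeta (1 + eps) ln (k + 2) ^ (1 + eps))], cutting the sum of
    the [s k ^ 2] into dyadic blocks bounds it by [8 c0^2] whatever [eps] is, at
    the price of a factor [sqrt (zeta (1 + eps))] in [1 / s k], which
    [h_sigma] dominates. *)

(** * Euclidean inner product *)

Section dot_product.
Context {R : realType} {n : nat}.
Implicit Types (x y z : 'rV[R]_n) (a b : R).

Definition dot x y : R := \sum_i x ord0 i * y ord0 i.

Lemma enorm_sqr x : enorm x ^+ 2 = dot x x.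
Proof.
rewrite /enorm sqr_sqrtr; first by apply: eq_bigr => i _; rewrite expr2.
by apply: sumr_ge0 => i _; rewrite sqr_ge0.
Qed.

Lemma dot_ge0 x : 0 <= dot x x.
Proof. by rewrite -enorm_sqr sqr_ge0. Qed.

Lemma enorm_ge0 x : 0 <= enorm x.
Proof. exact: sqrtr_ge0. Qed.

Lemma dotC x y : dot x y = dot y x.
Proof. by apply: eq_bigr => i _; rewrite mulrC. Qed.

Lemma dotDl x y z : dot (x + y) z = dot x z + dot y z.
Proof. by rewrite -big_split; apply: eq_bigr => i _ /=; rewrite mxE mulrDl. Qed.

Lemma dotZl a x y : dot (a *: x) y = a * dot x y.
Proof. by rewrite [RHS]big_distrr; apply: eq_bigr => i _ /=; rewrite mxE mulrA. Qed.

Lemma dotNl x y : dot (- x) y = - dot x y.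
Proof. by rewrite -scaleN1r dotZl mulN1r. Qed.

Lemma dotDr x y z : dot z (x + y) = dot z x + dot z y.
Proof. by rewrite dotC dotDl !(dotC z). Qed.

Lemma dotZr a x y : dot x (a *: y) = a * dot x y.
Proof. by rewrite dotC dotZl dotC. Qed.

Lemma dotNr x y : dot x (- y) = - dot x y.
Proof. by rewrite dotC dotNl dotC. Qed.

Definition dotE := (dotDl, dotDr, dotNl, dotNr, dotZl, dotZr).

Lemma sqr_coord_le_dot x i : x ord0 i ^+ 2 <= dot x x.
Proof.
rewrite /dot (bigD1 i) //= -expr2 lerDl.
by apply: sumr_ge0 => j _; rewrite -expr2 sqr_ge0.
Qed.

Lemma dot_eq0 x y : dot x x = 0 -> dot x y = 0.
Proof.
move=> x0; apply: big1 => i _; suff -> : x ord0 i = 0 by rewrite mul0r.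
apply/eqP; rewrite -sqrf_eq0 eq_le sqr_ge0 andbT.
by rewrite -x0 sqr_coord_le_dot.
Qed.

Lemma cauchy_schwarz x y : dot x y ^+ 2 <= dot x x * dot y y.
Proof.
have [x0|x0] := eqVneq (dot x x) 0; first by rewrite dot_eq0// x0 mul0r expr0n.
have xp : 0 < dot x x by rewrite lt_def x0 dot_ge0.
have := dot_ge0 (dot x x *: y - dot x y *: x).
rewrite !dotE (dotC y x) => h.
have : 0 <= dot x x * (dot x x * dot y y - dot x y ^+ 2) by lra.
by rewrite pmulr_rge0// subr_ge0.
Qed.

Lemma dot_le_enorm x y : dot x y <= enorm x * enorm y.
Proof.
apply: (le_trans (ler_norm _)).
rewrite -ler_sqr ?nnegrE ?mulr_ge0 ?enorm_ge0 ?normr_ge0//.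
by rewrite -normrX ger0_norm ?sqr_ge0// exprMn !enorm_sqr cauchy_schwarz.
Qed.

End dot_product.

(** * Smooth convex functions and the one-step energy inequality *)

Section convex_smooth.
Context {R : realType} {n : nat}.
Variables (f : 'rV[R]_n -> R) (L : R).
Hypotheses (L_gt0 : 0 < L)
  (f_convex : convex_function [set: convex_lmodType 'rV[R]_n] f)
  (f_smooth : lsmooth L f).

Lemma derive_dot x v : 'D_v f x = dot (gradient f x) v.
Proof.
have df := f_smooth.1 x.
rewrite deriveE// [in LHS](row_sum_delta v) linear_sum /=.
apply: eq_bigr => i _; rewrite linearZ /= mxE mulrC.
by rewrite deriveE.
Qed.

Lemma convex_segment x y t : 0 <= t <= 1 ->
  f (t *: y + (1 - t) *: x) <= t * f y + (1 - t) * f x.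
Proof.
move=> /andP[t0 t1].
by have := f_convex (Itv01 t0 t1) (in_setT y) (in_setT x).
Qed.

Lemma derive_right_cvg x v :
  h^-1 * (f (h *: v + x) - f x) @[h --> 0^'+] --> dot (gradient f x) v.
Proof.
rewrite -derive_dot.
apply: cvg_dnbhs_at_right.
have := @diff_derivable R 'rV[R]_n R^o f x v (f_smooth.1 x).
by rewrite /derivable /derive.
Qed.

(** Convexity makes every difference quotient from [x] towards [y] at most
    [f y - f x]; let the increment tend to [0] from the right. *)
Lemma gradient_ineq x y : f x + dot (gradient f x) (y - x) <= f y.
Proof.
rewrite -lerBrDl.
refine (cvgr_to_le (@derive_right_cvg x (y - x)) _).
near=> h.
have h0 : 0 < h by near: h; exact: nbhs_right_gt.
have h1 : h <= 1 by near: h; exact: nbhs_right_le.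
rewrite mulrC ler_pdivrMr//.
have -> : h *: (y - x) + x = h *: y + (1 - h) *: x.
  by apply/rowP => i; rewrite !mxE; ring.
by have := @convex_segment x y h; rewrite h1 ltW// => /(_ isT); lra.
Unshelve. all: by end_near. Qed.

Variable xstar : 'rV[R]_n.
Hypothesis f_min : forall y, f xstar <= f y.

(** All right derivatives at a minimum are nonnegative, in the direction [- v]
    as well as [v]. *)
Lemma gradient_min v : dot (gradient f xstar) v = 0.
Proof.
have ge0 u : 0 <= dot (gradient f xstar) u.
  refine (cvgr_to_ge (@derive_right_cvg xstar u) _).
  near=> h.
  have h0 : 0 < h by near: h; exact: nbhs_right_gt.
  by apply: mulr_ge0; [rewrite invr_ge0 ltW | rewrite subr_ge0].
apply/eqP; rewrite eq_le ge0 andbT -oppr_ge0 -dotNr ge0.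
Unshelve. all: by end_near. Qed.

(** Convexity at [xstar + v] bounds the increase of [f] by the gradient there,
    which is [L]-close to the zero gradient at [xstar].  The constant is [L]
    and not [L / 2]: a single gradient stands for the integral of the gradients
    along the segment. *)
Lemma quadratic_upper_bound v : f (xstar + v) <= f xstar + L * dot v v.
Proof.
have h1 := gradient_ineq (xstar + v) xstar.
have h2 : dot (gradient f (xstar + v)) v <= L * dot v v.
  rewrite -[X in X <= _]subr0 -(gradient_min v) -dotNl -dotDl.
  apply: (le_trans (dot_le_enorm _ _)).
  have := f_smooth.2 (xstar + v) xstar; rewrite (addrAC xstar) subrr add0r.
  by move=> /(ler_wpM2r (enorm_ge0 v)); rewrite -mulrA -expr2 enorm_sqr.
move: h1; rewrite opprD addrA subrr add0r dotNr; lra.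
Qed.

(** The tangent plane at [x] stays below [f] also at [xstar + v], where [f]
    exceeds its minimum by at most [L |v|^2]; the choice
    [v = gradient f x / (2 L)] gains the squared gradient. *)
Lemma gradient_ineq_min x :
  f x + dot (gradient f x) (xstar - x) +
    dot (gradient f x) (gradient f x) / (4 * L) <= f xstar.
Proof.
set G := gradient f x.
have h1 := quadratic_upper_bound ((2 * L)^-1 *: G).
have h2 := gradient_ineq x (xstar + (2 * L)^-1 *: G).
move: h2; rewrite -/G addrAC (dotDr (xstar - x)) !dotZr => h2.
move: h1; rewrite dotZl dotZr => h1.
have e : L * ((2 * L)^-1 * ((2 * L)^-1 * dot G G)) = dot G G / (4 * L).
  by field; rewrite gt_eqF.
have e2 : (2 * L)^-1 * dot G G = 2 * (dot G G / (4 * L)).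
  by field; rewrite gt_eqF.
by lra.
Qed.

(** The extrapolated point moves by [- 2 s g], so that the squared distance to
    [xstar] expands exactly.  Convexity at [xp] and [gradient_ineq_min] turn the
    cross term into function values, with a squared gradient to spare; under
    [8 L s <= 1] it absorbs the contribution of the gradient to [|g|^2]. *)
Lemma lyapunov_step (x xp xn g : 'rV[R]_n) (k : nat) (s : R) :
  let z := x + k%:R *: (x - xp) in
  let zn := xn + k.+1%:R *: (xn - x) in
  let nu := g - gradient f x in
  0 < s -> 8 * L * s <= 1 ->
  xn = x + (k%:R / (k + 2)%:R) *: (x - xp) - (2 * s / (k + 2)%:R) *: g ->
  dot (zn - xstar) (zn - xstar) + 4 * s * k.+1%:R * (f x - f xstar) <=
  dot (z - xstar) (z - xstar) + 4 * s * k%:R * (f xp - f xstar)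
    - 4 * s * dot nu (z - xstar) + 8 * s ^+ 2 * dot nu nu.
Proof.
move=> z zn nu s0 sL xnE.
have -> : zn - xstar = (z - xstar) - (2 * s) *: g.
  apply/rowP => i; rewrite /zn /z xnE !mxE.
  have k2 : k%:R + 2 != 0 :> R by rewrite -natrD pnatr_eq0 addn2.
  by rewrite natrD -natr1; field.
set G := gradient f x in nu *.
have gE : g = G + nu by rewrite /nu addrCA subrr addr0.
clearbody nu.
have hz : dot G (z - xstar) = k%:R * dot G (x - xp) - dot G (xstar - x).
  by rewrite /z !dotE; ring.
have h1 : f x + dot G (xstar - x) + dot G G / (4 * L) <= f xstar.
  exact: gradient_ineq_min.
have h2 : f x - f xp <= dot G (x - xp).
  have := @gradient_ineq x xp; rewrite -/G -(opprB x xp) dotNr; lra.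
have h3 : 0 <= dot (G - nu) (G - nu) by exact: dot_ge0.
have h4 : k%:R * (f x - f xp) <= k%:R * dot G (x - xp).
  by rewrite ler_wpM2l// ler0n.
have h5 : 2 * s * dot G G <= dot G G / (4 * L).
  rewrite ler_pdivlMr ?mulr_gt0// mulrAC -[leRHS]mul1r ler_wpM2r ?dot_ge0//.
  lra.
have h6 : dot (z - xstar - (2 * s) *: g) (z - xstar - (2 * s) *: g) =
    dot (z - xstar) (z - xstar) - 4 * s * (dot G (z - xstar) + dot nu (z - xstar))
    + 4 * s ^+ 2 * (dot G G + 2 * dot G nu + dot nu nu).
  rewrite gE; move: (z - xstar) => y.
  rewrite !dotE (dotC nu G) (dotC y G) (dotC y nu); ring.
rewrite h6 hz -natr1.
have h7 : dot (G - nu) (G - nu) = dot G G - 2 * dot G nu + dot nu nu.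
  rewrite !dotE (dotC nu G); ring.
have h8 : 0 <= s * (4 * (k%:R * dot G (x - xp) - dot G (xstar - x)
   - (k%:R * (f x - f xp) + (f x - f xstar) + 2 * s * dot G G))).
  by apply: mulr_ge0; [exact: ltW|lra].
have h9 : 0 <= s ^+ 2 * dot (G - nu) (G - nu) by rewrite mulr_ge0// sqr_ge0.
rewrite h7 in h9; lra.
Qed.

End convex_smooth.

(** * Exponential inequalities for sub-Gaussian increments *)

Section exponential_inequalities.
Context {R : realType}.
Implicit Types (y q r s v theta : R).

(** Shifting [y] itself to the right-hand side, and not only [1 + y], leaves a
    remainder that is even in [y]: after taking means of a centred [y], only
    its square counts. *)
Lemma expR_le_addl_sqr y : expR y <= y + expR (2 * y ^+ 2).
Proof.
have [y2|y2] := leP y 2^-1.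
  (* here [exp y <= 1 / (1 - y) = 1 + y + y^2 / (1 - y)] *)
  apply: (@le_trans _ _ (y + (1 + 2 * y ^+ 2))); last first.
    by rewrite lerD2l expR_ge1Dx.
  have y1 : 0 < 1 - y by lra.
  have h : expR y * (1 - y) <= 1.
    rewrite -[leRHS](expRxMexpNx_1 y) ler_wpM2l ?expR_ge0//.
    exact: expR_ge1Dx.
  rewrite -(ler_pM2r y1); apply: (le_trans h).
  have -> : (y + (1 + 2 * y ^+ 2)) * (1 - y) = 1 + y ^+ 2 * (1 - 2 * y) by ring.
  by rewrite lerDl mulr_ge0 ?sqr_ge0//; lra.
apply: (@le_trans _ _ (expR (2 * y ^+ 2))); last by rewrite lerDr; lra.
rewrite ler_expR; have : 0 <= y * (2 * y - 1) by apply: mulr_ge0; lra.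
lra.
Qed.

(** Convexity of [exp] between [0] and [s]. *)
Lemma expR_le_chord theta s : 0 <= theta <= 1 ->
  expR (theta * s) <= 1 + theta * (expR s - 1).
Proof.
move=> /andP[t0 t1].
have h1 : 1 - theta * s <= expR (- (theta * s)) by exact: expR_ge1Dx.
have h2 : 1 + (s - theta * s) <= expR (s - theta * s) by exact: expR_ge1Dx.
have h : 1 <= (1 - theta) * expR (- (theta * s)) + theta * expR (s - theta * s).
  have t1' : 0 <= 1 - theta by lra.
  have := ler_wpM2l t1' h1; have := ler_wpM2l t0 h2; lra.
have := ler_wpM2l (expR_ge0 (theta * s)) h.
rewrite mulr1 mulrDr 2!(mulrCA (expR (theta * s))) -!expRD subrr expR0.
by rewrite (addrC (theta * s)) subrK; lra.
Qed.

(** Read [y] as a centred linear form of a noise vector, [r] as the squared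
    norm of that vector in units of [sigma], and [v] as the squared norm of the
    form.  The right-hand side is affine in [y] and in [exp (r - 1)], hence its
    conditional mean is at most [exp (10 v + 2 q)] as soon as those of [y] and
    [exp (r - 1)] are at most [0] and [1].  Working pointwise allows [v] to be
    random and unbounded, which forces the two regimes of the proof. *)
Lemma expR_subgaussian y q r v : 0 <= r -> 0 <= v -> 0 <= q <= 4^-1 ->
  y ^+ 2 <= v * r ->
  expR (y + q * r) <= y + expR (10 * v + 2 * q) *
    (1 + Num.min (8 * v + 2 * q) 1 * (expR (r - 1) - 1)).
Proof.
move=> r0 v0 /andP[q0 q4] yvr.
have vr0 : 0 <= v * r by exact: mulr_ge0.
have qr0 : 0 <= q * r by exact: mulr_ge0.
have qr4 : q * r <= r / 4 by rewrite mulrC ler_wpM2l.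
have [small|large] := leP (8 * v + 2 * q) 1.
  set th := 8 * v + 2 * q.
  have th01 : 0 <= th <= 1 by rewrite /th small andbT; lra.
  (* small [v]: separate the two parts of the exponent, then interpolate [exp (th r)]
     between [1] and [exp r] *)
  have am_gm : expR (y + q * r) <= (expR (2 * y) + expR (2 * (q * r))) / 2.
    have := sqr_ge0 (expR y - expR (q * r)).
    rewrite expRD -!(mulrC _ 2) !expRM_natr; lra.
  have e1 : expR (2 * y) <= 2 * y + expR (th * r).
    apply: (le_trans (expR_le_addl_sqr _)); rewrite lerD2l ler_expR /th; lra.
  have e2 : expR (2 * (q * r)) <= expR (th * r) by rewrite ler_expR /th; lra.
  have e3 : expR (th * r) <= expR (10 * v + 2 * q) *
      (1 + th * (expR (r - 1) - 1)).
    rewrite (_ : th * r = th + th * (r - 1)); last by ring.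
    rewrite (expRD th); apply: ler_pM; rewrite ?expR_ge0//.
      by rewrite ler_expR /th; lra.
    exact: expR_le_chord.
  lra.
(* large [v]: [y] is crudely bounded by [t], and [exp t + t <= exp (2 t)] keeps [y]
   on the right-hand side *)
set t := v + r / 2.
have yt : `|y| <= v + r / 4.
  rewrite -ler_sqr ?nnegrE//; last by lra.
  rewrite real_normK ?num_real//; apply: (le_trans yvr).
  have := sqr_ge0 (v - r / 4); lra.
have [y1 y2] : - (v + r / 4) <= y /\ y <= v + r / 4 by move: yt; rewrite ler_norml => /andP[].
have t0 : 0 <= t by rewrite /t; lra.
have e1 : expR (y + q * r) <= expR t by rewrite ler_expR /t; lra.
have e2 : expR t + t <= expR (2 * t).
  rewrite (_ : 2 * t = t + t); last by ring.
  rewrite expRD; have ht := expR_ge1Dx t.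
  have : 0 <= (expR t - 1) * (expR t - 1 - t) by apply: mulr_ge0; lra.
  have : 0 <= t * (expR t - 1) by apply: mulr_ge0; lra.
  lra.
have e3 : expR (2 * t) <= expR (10 * v + 2 * q) * expR (r - 1).
  by rewrite -expRD ler_expR /t; lra.
by rewrite mul1r addrCA subrr addr0; rewrite /t in e1 e2 e3 *; lra.
Qed.

End exponential_inequalities.

(** One step of the exponential potential, in terms of a displacement [y], a
    noise vector [nu] and the current energy [V].  The three definitions below
    are the coefficients of the affine majorant of the next potential: they
    depend on the past only. *)
Section exponential_potential.
Context {R : realType} {n : nat}.
Variables (y nu : 'rV[R]_n) (V lam a sigma s Q : R).
Hypotheses (sigma_gt0 : 0 < sigma) (aE : a = sigma ^+ 2 * s ^+ 2)
  (yV : dot y y <= V).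

Let lam' := lam - 160 * a.
Let v := 16 * lam' ^+ 2 * a * dot y y.
Let q := 8 * lam' * a.

Definition exp_slope : 'rV[R]_n :=
  expR (lam' * V - 16 * (Q + a)) *: ((- (4 * lam' * s)) *: y).

Definition exp_level : R :=
  expR (lam' * V - 16 * (Q + a)) * expR (10 * v + 2 * q).

Definition exp_weight : R :=
  exp_level * Num.min (8 * v + 2 * q) 1 / expR 1.

Hypotheses (lam'_bounds : 0 <= lam' <= 1) (a_le : a <= 32^-1).

Let a_ge0 : 0 <= a. Proof. by rewrite aE mulr_ge0 ?sqr_ge0. Qed.

Let v_ge0 : 0 <= v.
Proof. exact: (mulr_ge0 (mulr_ge0 (mulr_ge0 (ler0n _ 16) (sqr_ge0 _)) a_ge0) (dot_ge0 y)). Qed.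

Let q_ge0 : 0 <= q.
Proof. by have /andP[l0 _] := lam'_bounds; exact: (mulr_ge0 (mulr_ge0 (ler0n _ 8) l0) a_ge0). Qed.

(** [expR_subgaussian] for the linear form [- 4 lam' s y]. *)
Lemma exp_potential_step V' :
  V' <= V - 4 * s * dot nu y + 8 * s ^+ 2 * dot nu nu ->
  expR (lam' * V' - 16 * (Q + a)) <=
  dot exp_slope nu + (exp_level + exp_weight * (expR (dot nu nu / sigma ^+ 2) - expR 1)).
Proof.
move=> V'le; have /andP[l0 l1] := lam'_bounds.
have sig0 : sigma ^+ 2 != 0 by rewrite gt_eqF// exprn_gt0.
set r := dot nu nu / sigma ^+ 2; set u := (- (4 * lam' * s)) *: y.
have rE : dot nu nu = sigma ^+ 2 * r by rewrite /r mulrCA mulfV ?mulr1.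
have r0 : 0 <= r by rewrite divr_ge0 ?dot_ge0 ?sqr_ge0.
have uv : dot u nu ^+ 2 <= v * r.
  apply: (le_trans (cauchy_schwarz _ _)); rewrite rE /u dotZl dotZr /v aE.
  by rewrite le_eqVlt; apply/orP; left; apply/eqP; ring.
have q4 : 0 <= q <= 4^-1.
  have h : lam' * a <= 1 * a by rewrite ler_wpM2r.
  rewrite q_ge0 /= /q -mulrA; apply: (@le_trans _ _ (8 * 32^-1)); last by lra.
  by rewrite ler_wpM2l// (le_trans h)// mul1r.
have h := expR_subgaussian r0 v_ge0 q4 uv.
have exponent : lam' * V' - 16 * (Q + a) <=
    lam' * V - 16 * (Q + a) + (dot u nu + q * r).
  have := ler_wpM2l l0 V'le; rewrite rE /u dotZl (dotC y) /q aE; lra.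
apply: (@le_trans _ _ (expR (lam' * V - 16 * (Q + a) + (dot u nu + q * r)))).
  by rewrite ler_expR.
rewrite expRD; apply: (le_trans (ler_wpM2l (expR_ge0 _) h)).
rewrite /exp_slope -/u /exp_weight /exp_level (dotZl (expR _)) (expRB r).
rewrite le_eqVlt; apply/orP; left; apply/eqP. by field; rewrite gt_eqF// expR_gt0.
Qed.

(** The weight of [V] drops by [160 a], which pays for
    [10 v = 160 lam'^2 a |y|^2] since [lam' <= 1] and [|y|^2 <= V]; the shift of
    [Q] by [a] pays for [2 q = 16 lam' a]. *)
Lemma exp_level_le : exp_level <= expR (lam * V - 16 * Q).
Proof.
have /andP[l0 l1] := lam'_bounds.
rewrite /exp_level -expRD ler_expR.
have h1 : lam' * a <= 1 * a by rewrite ler_wpM2r.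
have h2 : lam' ^+ 2 * (a * dot y y) <= 1 * (a * V).
  apply: ler_pM; rewrite ?sqr_ge0 ?mulr_ge0 ?dot_ge0// ?ler_wpM2l//.
  by rewrite expr_le1.
rewrite /v /q; move: h1 h2; rewrite (_ : lam = lam' + 160 * a); last by rewrite /lam'; ring.
move: lam' => l; lra.
Qed.

Lemma exp_base_le : expR (lam' * V - 16 * (Q + a)) <= exp_level.
Proof.
rewrite /exp_level ler_peMr ?expR_ge0// -expR0 ler_expR.
by rewrite addr_ge0// mulr_ge0.
Qed.

Lemma exp_weight_bounds : 0 <= exp_weight <= exp_level.
Proof.
have lv0 : 0 <= exp_level by rewrite mulr_ge0 ?expR_ge0.
have e0 : 0 < expR 1 :> R by exact: expR_gt0.
have m0 : 0 <= Num.min (8 * v + 2 * q) 1.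
  by rewrite le_min ler01 andbT addr_ge0// mulr_ge0.
apply/andP; split; first by rewrite divr_ge0 ?mulr_ge0 ?expR_ge0.
rewrite /exp_weight -mulrA -[leRHS]mulr1 ler_wpM2l//.
rewrite ler_pdivrMr// mul1r; apply: (@le_trans _ _ 1).
  by rewrite ge_min lexx orbT.
by rewrite -expR0 ler_expR.
Qed.

End exponential_potential.

(** * The zeta function and dyadic summation *)

Section zeta_bounds.
Context {R : realType}.
Implicit Types (eps : R) (m n : nat).

(** With [t = ln (m + 2) - ln (m + 1) >= 1 / (m + 2)], the quotient of the two
    powers on the right is [exp (eps t) >= 1 + eps / (m + 2)]. *)
Lemma powR_telescope eps m : 0 <= eps ->
  eps * m.+2%:R `^ (- (1 + eps)) <= m.+1%:R `^ (- eps) - m.+2%:R `^ (- eps).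
Proof.
move=> e0.
have m0 : 0 < m.+1%:R :> R by rewrite ltr0n.
have p0 : 0 < m.+2%:R :> R by rewrite ltr0n.
have pE (a : R) : m.+2%:R `^ a = expR (a * ln m.+2%:R) by rewrite /powR gt_eqF.
have mE (a : R) : m.+1%:R `^ a = expR (a * ln m.+1%:R) by rewrite /powR gt_eqF.
have lnle : ln m.+1%:R <= ln m.+2%:R - m.+2%:R^-1 :> R.
  rewrite -ler_expR lnK ?posrE// expRD lnK ?posrE//.
  have h := ler_wpM2l (ltW p0) (expR_ge1Dx (- m.+2%:R^-1 : R)).
  by apply: le_trans h; rewrite mulrDr mulr1 mulrN mulfV ?gt_eqF// -(natr1 m.+1) addrK.
have h1 : 1 + eps / m.+2%:R <= expR (eps * (ln m.+2%:R - ln m.+1%:R)).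
  apply: le_trans (expR_ge1Dx _); rewrite lerD2l ler_wpM2l//.
  by rewrite lerBrDr addrC -lerBrDr.
have h2 := ler_wpM2l (expR_ge0 (- eps * ln m.+2%:R)) h1.
rewrite -expRD in h2.
have h3 : - eps * ln m.+2%:R + eps * (ln m.+2%:R - ln m.+1%:R) =
  - eps * ln m.+1%:R :> R by ring.
rewrite h3 in h2; rewrite (pE (- eps)) (mE (- eps)).
have -> : m.+2%:R `^ (- (1 + eps)) = m.+2%:R^-1 * expR (- eps * ln m.+2%:R).
  rewrite pE (_ : - (1 + eps) * ln m.+2%:R = - ln m.+2%:R + - eps * ln m.+2%:R); last by ring.
  by rewrite expRD expRN lnK ?posrE.
rewrite lerBrDr; apply: le_trans h2.
by rewrite mulrDr mulr1 addrC lerD2l mulrA mulrC.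
Qed.

Lemma zeta_partial_bounded eps n : 0 < eps ->
  series (fun m : nat => m.+1%:R `^ (- (1 + eps))) n <= 1 + eps^-1.
Proof.
move=> e0.
suff h k : series (fun m : nat => m.+1%:R `^ (- (1 + eps))) k.+1 <=
    1 + eps^-1 * (1 - k.+1%:R `^ (- eps)) :> R.
  case: n => [|n]; first by rewrite /series /= big_geq// addr_ge0// invr_ge0 ltW.
  apply: (le_trans (h n)); rewrite lerD2l -[leRHS]mulr1 ler_wpM2l//.
    by rewrite invr_ge0 ltW.
elim: k => [|k IH].
  by rewrite /series /= big_nat1 !powR1 subrr mulr0 addr0.
rewrite seriesSr; apply: (le_trans (lerD IH (lexx _))).
have h := powR_telescope k (ltW e0).
have e0' : 0 <= eps^-1 by rewrite invr_ge0 ltW.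
have := ler_wpM2l e0' h; rewrite mulKf ?gt_eqF// => h2; lra.
Qed.

(** The zeta value is a limit, so convergence comes first: the partial sums
    increase, and telescoping bounds them. *)
Lemma series_le_zeta eps n : 0 < eps ->
  series (fun m : nat => m.+1%:R `^ (- (1 + eps))) n <= zeta (1 + eps).
Proof.
move=> e0; rewrite /zeta.
have nd : nondecreasing_seq (series (fun m : nat => m.+1%:R `^ (- (1 + eps)) : R)).
  by apply/nondecreasing_seqP => k; rewrite seriesSr lerDl powR_ge0.
apply: nondecreasing_cvgn_le => //.
apply: nondecreasing_is_cvgn => //.
exists (1 + eps^-1) => _ [k _ <-]; exact: zeta_partial_bounded.
Qed.

Lemma zeta_ge1 eps : 0 < eps -> 1 <= zeta (1 + eps).
Proof.
move=> /(series_le_zeta 1); rewrite /series /= big_nat1.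
by rewrite powR1.
Qed.

Lemma ln2_ge_half : 2^-1 <= ln 2 :> R.
Proof.
rewrite -ler_expR lnK ?posrE//.
have h : 1 - 2^-1 <= expR (- 2^-1) :> R by exact: expR_ge1Dx.
have := ler_wpM2l (expR_ge0 (2^-1 : R)) h; rewrite expRxMexpNx_1; lra.
Qed.

(** Both [m ln 2] and [ln 2] are below [ln (k + 2)], and [ln 2 >= 1 / 2]. *)
Lemma dyadic_le_ln m k : (2 ^ m <= k)%N -> m.+1%:R <= 4 * ln (k + 2)%:R :> R.
Proof.
move=> mk.
have h1 : m%:R * ln 2 <= ln (k + 2)%:R :> R.
  rewrite mulr_natl -lnXn// ler_ln ?posrE ?exprn_gt0 ?ltr0n ?addn2//.
  by rewrite -natrX ler_nat; lia.
have h2 : ln 2 <= ln (k + 2)%:R :> R.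
  by rewrite ler_ln ?posrE ?ltr0n ?addn2// ler_nat.
have h3 : m.+1%:R * 2^-1 <= m.+1%:R * ln 2 :> R.
  by rewrite ler_wpM2l ?ler0n// ln2_ge_half.
by rewrite -natr1 in h3 *; lra.
Qed.

Lemma ln_natD2_gt0 k : 0 < ln (k + 2)%:R :> R.
Proof. by rewrite ln_gt0// ltr1n addn2. Qed.

Lemma dyadic_term_le eps m k : 0 < eps < 2^-1 -> (2 ^ m <= k)%N ->
  (k%:R * ln (k + 2)%:R `^ (1 + eps))^-1 <=
  8 * ((2 ^ m)%:R^-1 * m.+1%:R `^ (- (1 + eps))) :> R.
Proof.
move=> /andP[e0 e2] mk.
have p0 : (0 < 2 ^ m)%N by rewrite expn_gt0.
have k0 : 0 < k%:R :> R by rewrite ltr0n; exact: leq_trans mk.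
have l0 := ln_natD2_gt0 k.
rewrite powRN -invfM -[8]invrK -invfM lef_pV2 ?posrE; last 2 first.
- by rewrite mulr_gt0 ?powR_gt0.
- by rewrite !mulr_gt0 ?powR_gt0 ?ltr0n.
rewrite mulrCA; apply: ler_pM; rewrite ?ler_nat ?ler0n//.
rewrite ler_pdivrMl//; apply: (@le_trans _ _ ((4 * ln (k + 2)%:R) `^ (1 + eps))).
  by apply: ge0_ler_powR; rewrite ?nnegrE ?ler0n ?dyadic_le_ln//; lra.
rewrite powRM//; last exact: ltW.
rewrite ler_wpM2r ?powR_ge0//.
have -> : (4 : R) = 2 `^ 2 by rewrite (powR_mulrn 2)//; ring.
rewrite -powRrM; apply: (@le_trans _ _ (2 `^ 3)).
  (* [4 ^ (1 + eps) <= 8], as [eps < 1 / 2] *)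
  by apply: ler_powR; lra.
by rewrite (powR_mulrn 3)//; lra.
Qed.

(** Cauchy condensation: each dyadic block [2 ^ m <= k < 2 ^ m.+1] contributes at
    most [8] times the term of index [m] of the zeta series. *)
Lemma sum_inv_ln_le_zeta eps n : 0 < eps < 2^-1 ->
  \sum_(1 <= k < n) (k%:R * ln (k + 2)%:R `^ (1 + eps))^-1 <= 8 * zeta (1 + eps) :> R.
Proof.
move=> eps02; have /andP[e0 _] := eps02.
have t0 k : 0 <= (k%:R * ln (k + 2)%:R `^ (1 + eps))^-1 :> R.
  by rewrite invr_ge0 mulr_ge0 ?ler0n ?powR_ge0.
apply: (@le_trans _ _ (\sum_(1 <= k < 2 ^ n) (k%:R * ln (k + 2)%:R `^ (1 + eps))^-1)).
  have [n0|n1] := leqP n 1; first by rewrite big_geq// sumr_ge0.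
  have n2 : (n <= 2 ^ n)%N by apply: ltnW; exact: ltn_expl.
  rewrite (big_cat_nat (ltnW n1) n2)/=.
  by rewrite lerDl sumr_ge0.
apply: (@le_trans _ _ (8 * series (fun m : nat => m.+1%:R `^ (- (1 + eps))) n)); last first.
  by rewrite ler_wpM2l// series_le_zeta.
elim: n => [|n IH]; first by rewrite big_geq// /series /= big_geq ?mulr0.
rewrite seriesSr mulrDr (big_cat_nat (n := 2 ^ n)) ?expn_gt0//=; last first.
  by rewrite leq_exp2l.
apply: lerD => //.
apply: (@le_trans _ _ (\sum_(2 ^ n <= k < 2 ^ n.+1)
    (8 * ((2 ^ n)%:R^-1 * n.+1%:R `^ (- (1 + eps)))))).
  rewrite big_nat_cond [leRHS]big_nat_cond; apply: ler_sum => k /andP[/andP[nk _] _].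
  exact: dyadic_term_le.
rewrite sumr_const_nat expnS mul2n -addnn addnK -[leLHS]mulr_natr.
rewrite -!mulrA ler_wpM2l// mulrCA mulVf ?mulr1//.
Qed.

End zeta_bounds.

(** * Step sizes *)

Section step_sizes.
Context {R : realType}.
Variables (c0 eps : R).
Hypotheses (c0_gt0 : 0 < c0) (eps_bounds : 0 < eps < 2^-1).

(** Dividing by the zeta value makes the sum of the squared steps bounded
    independently of [eps]. *)
Definition sgdm_eta (k : nat) : R :=
  c0 ^+ 2 / (zeta (1 + eps) * ln (k + 2)%:R `^ (1 + eps)).

(** The step at index [0], where the formula degenerates, repeats the step at
    index [1]; this keeps the sequence positive and nonincreasing. *)
Definition sgdm_step (k : nat) : R :=
  Num.sqrt (sgdm_eta (maxn k 1) / (maxn k 1)%:R).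

Let eps_gt0 : 0 < eps. Proof. by case/andP: eps_bounds. Qed.

Let zeta_gt0 : 0 < zeta (1 + eps).
Proof. exact: lt_le_trans ltr01 (zeta_ge1 eps_gt0). Qed.

Lemma sgdm_eta_gt0 k : 0 < sgdm_eta k.
Proof.
by rewrite divr_gt0 ?exprn_gt0// mulr_gt0// powR_gt0// ln_natD2_gt0.
Qed.

Let maxn1_gt0 k : 0 < (maxn k 1)%:R :> R.
Proof. by rewrite ltr0n leq_max orbT. Qed.

Lemma sgdm_step_gt0 k : 0 < sgdm_step k.
Proof. by rewrite sqrtr_gt0 divr_gt0// sgdm_eta_gt0. Qed.

Lemma sgdm_step_sqr k :
  sgdm_step k ^+ 2 = sgdm_eta (maxn k 1) / (maxn k 1)%:R.
Proof. by rewrite sqr_sqrtr// divr_ge0// ltW ?sgdm_eta_gt0. Qed.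

Lemma sgdm_stepE k : (1 <= k)%N ->
  sgdm_step k = Num.sqrt (sgdm_eta k) / Num.sqrt k%:R.
Proof.
move=> k1; rewrite /sgdm_step (maxn_idPl k1) sqrtrM ?ltW ?sgdm_eta_gt0//.
by rewrite sqrtrV// ler0n.
Qed.

Lemma sgdm_step_nonincreasing k : sgdm_step k.+1 <= sgdm_step k.
Proof.
apply: ler_wsqrtr; rewrite (maxn_idPl (ltn0Sn k)).
have mk : (maxn k 1 <= k.+1)%N by rewrite geq_max leqnSn.
apply: ler_pM; rewrite ?invr_ge0 ?ler0n //.
- exact: ltW (sgdm_eta_gt0 _).
- rewrite ler_wpM2l ?sqr_ge0// lef_pV2 ?posrE ?mulr_gt0 ?powR_gt0 ?ln_natD2_gt0//.
  rewrite ler_wpM2l ?(ltW zeta_gt0)// ge0_ler_powR ?nnegrE ?(ltW (ln_natD2_gt0 _))//.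
    by rewrite addr_ge0// ltW.
  by rewrite ler_ln ?posrE ?ltr0n ?addn_gt0 ?orbT// ler_nat leq_add2r.
- by rewrite lef_pV2 ?posrE ?ltr0n// ?ler_nat ?leq_max ?orbT.
Qed.

Lemma sum_sqr_step n : \sum_(1 <= k < n) sgdm_step k ^+ 2 <= 8 * c0 ^+ 2.
Proof.
have -> : \sum_(1 <= k < n) sgdm_step k ^+ 2 = (c0 ^+ 2 / zeta (1 + eps)) *
    \sum_(1 <= k < n) (k%:R * ln (k + 2)%:R `^ (1 + eps))^-1.
  rewrite big_distrr/= !big_nat; apply: eq_bigr => k /andP[k1 _].
  rewrite sgdm_step_sqr (maxn_idPl k1) /sgdm_eta !invfM.
  by ring.
apply: (@le_trans _ _ (c0 ^+ 2 / zeta (1 + eps) * (8 * zeta (1 + eps)))).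
  by rewrite ler_wpM2l ?sum_inv_ln_le_zeta// divr_ge0 ?sqr_ge0// ltW.
by rewrite mulrCA -mulrA mulVf ?mulr1// gt_eqF.
Qed.

Lemma sgdm_step_le k : sgdm_step k <= 3 * c0.
Proof.
suff h j : (1 <= j)%N -> sgdm_step j <= 3 * c0.
  have [k1|] := leqP 1 k; first exact: h.
  rewrite ltnS leqn0 => /eqP ->; exact: (h 1%N).
move=> j1.
have h : sgdm_step j ^+ 2 <= 8 * c0 ^+ 2.
  apply: le_trans (sum_sqr_step j.+1); rewrite big_nat_recr//= lerDr.
  by apply: sumr_ge0 => i _; rewrite sqr_ge0.
rewrite -ler_sqr ?nnegrE ?(ltW (sgdm_step_gt0 _))//; last by rewrite mulr_ge0// ltW.
by apply: (le_trans h); have := sqr_ge0 c0; lra.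
Qed.

(** The step loses a factor [sqrt (zeta (1 + eps))], which is at most the square
    of the zeta value since the latter is at least [1]. *)
Lemma inv_step_le k : (1 <= k)%N ->
  (sgdm_step k * k.+1%:R)^-1 <=
  c0^-1 * zeta (1 + eps) ^+ 2 * ln (k + 2)%:R `^ ((1 + eps) / 2)
    / Num.sqrt (k + 1)%:R.
Proof.
move=> k1.
have l0 := ln_natD2_gt0 (R := R) k.
set lp := ln (k + 2)%:R `^ _.
have lp0 : 0 < lp by rewrite powR_gt0.
have k0 : 0 < k%:R :> R by rewrite ltr0n.
have stepE : sgdm_step k = c0 / (Num.sqrt (zeta (1 + eps)) * lp * Num.sqrt k%:R).
  rewrite sgdm_stepE// /sgdm_eta sqrtrM ?sqr_ge0// sqrtr_sqr gtr0_norm//.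
  rewrite sqrtrV ?mulr_ge0 ?powR_ge0 ?ltW// sqrtrM ?ltW//.
  have -> : Num.sqrt (ln (k + 2)%:R `^ (1 + eps)) = lp.
    by rewrite -powR12_sqrt ?powR_ge0// -powRrM.
  by rewrite !invfM !mulrA.
have z1 := zeta_ge1 eps_gt0.
have zs : Num.sqrt (zeta (1 + eps)) <= zeta (1 + eps) ^+ 2.
  rewrite -ler_sqr ?nnegrE ?sqrtr_ge0 ?sqr_ge0// sqr_sqrtr ?(ltW zeta_gt0)//.
  by rewrite -exprM -[leLHS]expr1 ler_weXn2l.
move: (zeta (1 + eps) ^+ 2) zs => z2 zs.
rewrite stepE !invfM !invrK -!mulrA ler_wpM2l ?invr_ge0 ?(ltW c0_gt0)//.
apply: ler_pM; rewrite ?sqrtr_ge0 ?mulr_ge0 ?invr_ge0 ?ler0n ?(ltW lp0)//.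
rewrite ler_wpM2l ?(ltW lp0)//.
rewrite ler_pdivrMr ?ltr0n// addn1 mulrC.
rewrite -{1}(@sqr_sqrtr _ k.+1%:R) ?ler0n// expr2 mulfK; last by rewrite gt_eqF// sqrtr_gt0 ltr0n.
by apply: ler_wsqrtr; rewrite ler_nat.
Qed.

End step_sizes.

(** * Weighting inequalities between integrals over a sub-sigma-algebra *)

Section sub_sigma_algebra.
Context {d : measure_display} {T : measurableType d} {R : realType}.
Variables (mu : {measure set T -> \bar R}) (G : set_system T).
Hypothesis G_sub : G `<=` measurable.

Lemma sigma_sub : <<s G >> `<=` (measurable : set_system T).
Proof. by apply: smallest_sub => //; exact: sigma_algebra_measurable. Qed.

Lemma measurable_fun_sigma_sub d' (U : measurableType d') (h : T -> U) :
  measurable_fun [set: g_sigma_algebraType G] (h : g_sigma_algebraType G -> U) ->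
  measurable_fun [set: T] h.
Proof.
by move=> mh _ Y mY; apply: sigma_sub; exact: (mh measurableT Y mY).
Qed.

Import HBNNSimple.

(** The level sets of [h] belong to the sub-sigma-algebra, so that such an integral
    only involves integrals of [X] over its members. *)
Lemma integral_nnsfun_weight (h : {nnsfun (g_sigma_algebraType G) >-> R})
    (X : T -> R) : measurable_fun setT X -> (forall x, 0 <= X x) ->
  (\int[mu]_x (h x * X x)%:E =
   \sum_(y \in range h) (y%:E * \int[mu]_(x in h @^-1` [set y]) (X x)%:E))%E.
Proof.
move=> mX X0.
have mlevel y : measurable (h @^-1` [set y] : set T).
  apply: sigma_sub.
  exact: (@measurable_funPTI _ _ (g_sigma_algebraType G) _ h _ (measurable_set1 y)).
transitivity (\int[mu]_x
    (\sum_(y \in range h) (y * \1_(h @^-1` [set y]) x * X x)%:E))%E.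
  apply: eq_integral => x _; rewrite fsumEFin//; congr EFin.
  by rewrite {1}(fimfunE h x) mulr_fsuml//.
have range_ge0 y : range h y -> 0 <= y by move=> [x _ <-].
have mweight y : measurable_fun [set: T]
    (fun x => (y * \1_(h @^-1` [set y]) x * X x)%:E).
  by apply/measurable_EFinP; apply: measurable_funM => //; exact: measurable_funM.
have weight_ge0 y x : [set: T] x -> (0 <= (y * \1_(h @^-1` [set y]) x * X x)%:E)%E.
  move=> _; rewrite lee_fin; apply: mulr_ge0 => //.
  by rewrite indicE; case: (boolP (x \in _)); rewrite ?mulr0// inE mulr1 => <-.
rewrite ge0_integral_fsum//.
apply: eq_fsbigr => y; rewrite inE => /range_ge0 y0.
under eq_integral => x _ do rewrite -mulrA EFinM.
rewrite ge0_integralZl//; last 2 first.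
- by apply/measurable_EFinP; exact: measurable_funM.
- by move=> x _; rewrite lee_fin mulr_ge0.
congr (_ * _)%E; rewrite [RHS]integral_mkcond; apply: eq_integral => x _.
by rewrite epatch_indic EFinM muleC.
Qed.

(** Clear for nonnegative simple weights; monotone convergence gives the general
    case. *)
Lemma le_integral_weighted (X1 X2 h : T -> R) :
  measurable_fun [set: T] X1 -> (forall x, 0 <= X1 x) ->
  measurable_fun [set: T] X2 -> (forall x, 0 <= X2 x) ->
  measurable_fun [set: g_sigma_algebraType G] (h : g_sigma_algebraType G -> R) ->
  (forall x, 0 <= h x) ->
  (forall B, <<s G >> B ->
    \int[mu]_(x in B) (X1 x)%:E <= \int[mu]_(x in B) (X2 x)%:E)%E ->
  (\int[mu]_x (h x * X1 x)%:E <= \int[mu]_x (h x * X2 x)%:E)%E.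
Proof.
move=> mX1 X10 mX2 X20 mh h0 le12.
pose g := @nnsfun_approx _ (g_sigma_algebraType G) R setT measurableT (EFin \o h)
  ((measurable_EFinP _ _).2 mh).
have mg n : measurable_fun [set: T] (g n : T -> R).
  by apply: measurable_fun_sigma_sub.
have cvg_int (X : T -> R) : measurable_fun [set: T] X -> (forall x, 0 <= X x) ->
    (\int[mu]_x (g n x * X x)%:E @[n --> \oo] --> \int[mu]_x (h x * X x)%:E)%E.
  move=> mX X0.
  have -> : (\int[mu]_x (h x * X x)%:E =
      \int[mu]_x (limn (fun n => (g n x * X x)%:E)))%E.
    apply: eq_integral => x _; apply/esym/cvg_lim => //.
    under eq_fun do rewrite EFinM; rewrite EFinM; apply: cvgeZr => //.
    by apply: cvg_nnsfun_approx => // y _; rewrite lee_fin.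
  apply: cvg_monotone_convergence => //.
  - by move=> n; apply/measurable_EFinP; exact: measurable_funM.
  - by move=> n x _; rewrite lee_fin mulr_ge0.
  - move=> x _ m n mn; rewrite lee_fin ler_wpM2r//.
    by have /lefP := nd_nnsfun_approx measurableT ((measurable_EFinP _ _).2 mh) mn; exact.
apply: (lee_cvg_to (cvg_int _ mX1 X10) (cvg_int _ mX2 X20)).
apply: nearW => n; rewrite !integral_nnsfun_weight//.
apply: lee_fsum; first exact: fimfunP.
move=> y [x _ <-]; rewrite lee_wpmul2l ?lee_fin//.
apply: le12.
exact: (@measurable_funPTI _ _ (g_sigma_algebraType G) _ (g n) _ (measurable_set1 _)).
Qed.

End sub_sigma_algebra.

Section conditional_expectation.
Context {d : measure_display} {T : measurableType d} {R : realType}.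
Variables (P : probability T R) (G : set_system T).
Hypothesis G_sub : G `<=` measurable.

Notation integrable_fun X := (P.-integrable [set: T] (EFin \o X)).
Notation G_measurable h :=
  (measurable_fun [set: g_sigma_algebraType G] (h : g_sigma_algebraType G -> R)).

Lemma integrable_bounded_mul (h X : T -> R) (M : R) :
  measurable_fun [set: T] h -> (forall w, `|h w| <= M) ->
  integrable_fun X -> integrable_fun (fun w => h w * X w).
Proof.
move=> mh hM iX.
apply: eq_integrable (integrableMr _ mh _ iX) => //.
by exists M; split; rewrite ?num_real// => x Mx y _; exact: le_trans (hM y) (ltW Mx).
Qed.

Lemma integrable_bounded (h : T -> R) (M : R) :
  measurable_fun [set: T] h -> (forall w, `|h w| <= M) -> integrable_fun h.
Proof.
move=> mh hM; apply: measurable_bounded_integrable => //.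
  by rewrite -ge0_fin_numE// fin_num_measure.
by exists M; split; rewrite ?num_real// => x Mx y _; exact: le_trans (hM y) (ltW Mx).
Qed.

Lemma EFin_Rintegral (X : T -> R) (B : set T) : measurable B -> integrable_fun X ->
  ((\int[P]_(w in B) X w)%R%:E = \int[P]_(w in B) (X w)%:E)%E.
Proof.
move=> mB iX; rewrite fineK//; apply: integrable_fin_num => //.
exact: integrableS iX.
Qed.

(** The weight [h + M] is nonnegative, and the positive and negative parts of [X]
    have the same integral on every member of [<<s G>>]:
    [le_integral_weighted] applies in both directions. *)
Lemma cond_mean_zero_mul (X h : T -> R) (M : R) : integrable_fun X ->
  (forall B, <<s G >> B -> \int[P]_(w in B) X w = 0) ->
  G_measurable h -> (forall w, `|h w| <= M) ->
  \int[P]_w (h w * X w) = 0.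
Proof.
move=> iX X0 mGh hM.
have mh : measurable_fun [set: T] h by exact: measurable_fun_sigma_sub mGh.
have mX : measurable_fun [set: T] X by exact/measurable_EFinP/measurable_int/iX.
pose Xp w := Num.max (X w) 0; pose Xm w := Num.max (- X w) 0.
have XE w : X w = Xp w - Xm w.
  rewrite /Xp /Xm; have [x0|x0] := leP 0 (X w).
    have -> : Num.max (- X w) 0 = 0 by apply/max_idPr; rewrite oppr_le0.
    by rewrite subr0.
  have -> : Num.max (- X w) 0 = - X w by apply/max_idPl; rewrite oppr_ge0 ltW.
  by rewrite opprK add0r.
have Xp0 w : 0 <= Xp w by rewrite le_max lexx orbT.
have Xm0 w : 0 <= Xm w by rewrite le_max lexx orbT.
have mXp : measurable_fun [set: T] Xp by exact: measurable_maxr.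
have mXm : measurable_fun [set: T] Xm.
  by apply: measurable_maxr => //; exact: measurableT_comp.
have iXp : integrable_fun Xp.
  apply: le_integrable iX => //; first exact/measurable_EFinP.
  move=> w _; rewrite lee_fin ger0_norm// /Xp ge_max normr_ge0 andbT.
  exact: ler_norm.
have iXm : integrable_fun Xm.
  apply: le_integrable iX => //; first exact/measurable_EFinP.
  by move=> w _; rewrite lee_fin ger0_norm// /Xm ge_max normr_ge0 andbT ler_normr lexx orbT.
have eqpm B : <<s G >> B ->
    (\int[P]_(w in B) (Xp w)%:E = \int[P]_(w in B) (Xm w)%:E)%E.
  move=> GB; have mB := sigma_sub G_sub GB.
  rewrite -!EFin_Rintegral//; congr EFin; apply/eqP; rewrite -subr_eq0.
  rewrite -RintegralB//; [|exact: integrableS iXp|exact: integrableS iXm].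
  by rewrite -(X0 _ GB); apply/eqP; apply: eq_Rintegral => w _.
pose k w := h w + M.
have k0 w : 0 <= k w by have := hM w; rewrite ler_norml => /andP[]; rewrite /k; lra.
have mGk : G_measurable k by apply: measurable_funD => //.
have mk : measurable_fun [set: T] k by exact: measurable_fun_sigma_sub mGk.
have kM w : `|k w| <= M + M by rewrite (le_trans (ler_normD _ _))// lerD// ?hM// ger0_norm// (le_trans _ (hM w)).
have eqk : \int[P]_w (k w * Xp w) = \int[P]_w (k w * Xm w).
  congr fine; apply/eqP; rewrite eq_le; apply/andP; split;
  by apply: (le_integral_weighted G_sub) => // B GB; rewrite eqpm.
have -> : \int[P]_w (h w * X w) =
    \int[P]_w ((k w * Xp w - k w * Xm w) - M * X w).
  by apply: eq_Rintegral => w _; rewrite /k (XE w); ring.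
have ikp : integrable_fun (fun w => k w * Xp w) by exact: integrable_bounded_mul kM iXp.
have ikm : integrable_fun (fun w => k w * Xm w) by exact: integrable_bounded_mul kM iXm.
rewrite RintegralB//; last 2 first.
- exact: integrableB ikp ikm.
- exact: integrableZl iX.
rewrite RintegralB// eqk subrr RintegralZl// X0 ?mulr0 ?subr0//.
exact: (@measurableT _ (g_sigma_algebraType G)).
Qed.

Lemma cond_le_mul (X h : T -> R) (c M : R) : 0 <= c ->
  measurable_fun [set: T] X -> (forall w, 0 <= X w) ->
  (forall B, <<s G >> B -> (\int[P]_(w in B) (X w)%:E <= \int[P]_(w in B) c%:E)%E) ->
  G_measurable h -> (forall w, 0 <= h w <= M) ->
  integrable_fun X /\ \int[P]_w (h w * X w) <= \int[P]_w (h w * c).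
Proof.
move=> c0 mX X0 Xc mGh hM.
have h0 w : 0 <= h w by case/andP: (hM w).
have mh : measurable_fun [set: T] h by exact: measurable_fun_sigma_sub mGh.
have hMn w : `|h w| <= M by rewrite ger0_norm//; case/andP: (hM w).
have ic : integrable_fun (cst c : T -> R).
  by apply: (@integrable_bounded _ `|c|).
have iX : integrable_fun X.
  apply/integrableP; split; first exact/measurable_EFinP.
  under eq_integral => w _ do rewrite gee0_abs ?lee_fin//.
  apply: le_lt_trans (Xc setT _) _.
    exact: (@measurableT _ (g_sigma_algebraType G)).
  by rewrite -(EFin_Rintegral measurableT ic) ltry.
split=> //.
rewrite -lee_fin !EFin_Rintegral//; last 2 first.
- exact: integrable_bounded_mul hMn ic.
- exact: integrable_bounded_mul hMn iX.
exact: (le_integral_weighted G_sub).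
Qed.

End conditional_expectation.

(** * Conditional expectations of noise *)

Section conditional_step.
Context {d : measure_display} {T : measurableType d} {R : realType}.
Variables (P : probability T R) (G : set_system T).
Hypothesis G_sub : G `<=` measurable.

Notation integrable_fun X := (P.-integrable [set: T] (EFin \o X)).
Notation G_measurable h :=
  (measurable_fun [set: g_sigma_algebraType G] (h : g_sigma_algebraType G -> R)).

(** A version of the conditional expectation may be negative on a null set, so the
    comparison passes through its positive part. *)
Lemma cond_exp_le_cst (X : T -> R) (c : R) : 0 <= c ->
  cond_exp_le P G X (fun=> c) ->
  forall B, <<s G >> B -> (\int[P]_(w in B) (X w)%:E <= \int[P]_(w in B) c%:E)%E.
Proof.
move=> c0 [Z [[mGZ XZ] Zc]] B GB.
have mB := sigma_sub G_sub GB.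
have mZ : measurable_fun [set: T] Z by exact: measurable_fun_sigma_sub mGZ.
have -> := XZ _ GB.
apply: (@le_trans _ _ (\int[P]_(w in B) (Z^\+ w))%E).
  rewrite [leLHS]integralE -[leRHS]adde0 leeD2l// leeNl oppe0.
  by apply: integral_ge0.
apply: ae_ge0_le_integral => //.
- by apply: measurable_funepos; exact: measurable_funTS.
- by move: Zc; apply: filterS => w h _; rewrite funeposE ge_max h lee_fin.
Qed.

Lemma integrable_of_fin_num (Y : T -> R) : measurable_fun [set: T] Y ->
  (\int[P]_w (Y w)%:E)%E \is a fin_num -> integrable_fun Y.
Proof.
move=> mY; rewrite integralE fin_numB => /andP[fp fn].
have mEY : measurable_fun [set: T] (EFin \o Y) by exact/measurable_EFinP.
apply/integrableP; split => //.
have -> : (\int[P]_w `|(EFin \o Y) w| =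
    \int[P]_w ((EFin \o Y)^\+ w + (EFin \o Y)^\- w))%E.
  apply: eq_integral => w _.
  by rewrite -[RHS]/(((EFin \o Y)^\+ \+ (EFin \o Y)^\-)%E w) -fune_abse.
rewrite ge0_integralD//; last 2 first.
- exact: measurable_funepos.
- exact: measurable_funeneg.
by rewrite ltey_eq fin_numD fp fn.
Qed.

(** The integral of [Y] over the whole space equals that of the integrable [X],
    which makes [Y] integrable and allows the integrals to be subtracted. *)
Lemma cond_exp_vec_noise n (X Y : T -> 'rV[R]_n) : cond_exp_vec_eq P G X Y ->
  forall i, integrable_fun (fun w => (X w - Y w) ord0 i) /\
    forall B, <<s G >> B -> \int[P]_(w in B) (X w - Y w) ord0 i = 0.
Proof.
move=> XY i; have [iX [mGY eXY]] := XY i.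
have GT : <<s G >> [set: T] by exact: (@measurableT _ (g_sigma_algebraType G)).
have mY : measurable_fun [set: T] (fun w => Y w ord0 i).
  apply/measurable_EFinP; exact: (measurable_fun_sigma_sub G_sub mGY).
have iY : integrable_fun (fun w => Y w ord0 i).
  apply: integrable_of_fin_num => //.
  by rewrite -(eXY _ GT); exact: integrable_fin_num.
have E w : (X w - Y w) ord0 i = X w ord0 i - Y w ord0 i by rewrite !mxE.
split=> [|B GB].
  rewrite (_ : EFin \o _ = EFin \o (fun w => X w ord0 i - Y w ord0 i)).
    exact: integrableB iX iY.
  by apply/funext => w /=; rewrite E.
have mB := sigma_sub G_sub GB.
under eq_Rintegral do rewrite E.
rewrite RintegralB//; [|exact: integrableS iX|exact: integrableS iY].
by apply/eqP; rewrite subr_eq0; apply/eqP; congr fine; exact: eXY.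
Qed.

Variables (n : nat) (D : set T) (S A k X : T -> R) (b nu : T -> 'rV[R]_n) (c M : R).

(** A variable dominated on [D] by an expression affine in a centred vector [nu]
    and in [X - c], with coefficients known to [<<s G>>] and bounded on [D],
    integrates to at most the constant term.  Integrability of [S] follows from
    the domination. *)
Lemma supermartingale_step :
  <<s G >> D -> 0 <= c -> 0 <= M ->
  measurable_fun [set: T] S -> (forall w, 0 <= S w) ->
  measurable_fun [set: T] X -> (forall w, 0 <= X w) ->
  (forall i, integrable_fun (fun w => nu w ord0 i) /\
    forall B, <<s G >> B -> \int[P]_(w in B) nu w ord0 i = 0) ->
  (forall B, <<s G >> B -> (\int[P]_(w in B) (X w)%:E <= \int[P]_(w in B) c%:E)%E) ->
  G_measurable A -> G_measurable k -> (forall i, G_measurable (fun w => b w ord0 i)) ->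
  (forall w, D w -> 0 <= A w <= M) ->
  (forall w, D w -> 0 <= k w <= M) ->
  (forall w i, D w -> `|b w ord0 i| <= M) ->
  (forall w, D w -> S w <= dot (b w) (nu w) + (A w + k w * (X w - c))) ->
  (\int[P]_(w in D) (S w)%:E <= \int[P]_(w in D) (A w)%:E)%E.
Proof.
move=> GD c0 M0 mS S0 mX X0 nu0 Xc mGA mGk mGb AM kM bM SA.
have mD := sigma_sub G_sub GD.
have mG1 : G_measurable (\1_D : T -> R).
  exact: (@measurable_indic _ (g_sigma_algebraType G) R setT D GD).
have m1 : measurable_fun [set: T] (\1_D : T -> R) by exact: measurable_indic.
have ind w : (D w /\ (\1_D w = 1 :> R)) \/ (~ D w /\ (\1_D w = 0 :> R)).
  by rewrite indicE; case: (boolP (w \in D)); rewrite ?(inE, notin_setE); [left|right].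
have intD (U : T -> R) :
    (\int[P]_(w in D) (U w)%:E = \int[P]_w (\1_D w * U w)%:E)%E.
  rewrite integral_mkcond; apply: eq_integral => w _.
  by rewrite epatch_indic/= -EFinM mulrC.
(* cutting the coefficients off outside [D] makes them globally bounded *)
pose A1 w := \1_D w * A w; pose k1 w := \1_D w * k w.
pose S1 w := \1_D w * S w; pose b1 i w := \1_D w * b w ord0 i.
have mGA1 : G_measurable A1 by exact: measurable_funM.
have mGk1 : G_measurable k1 by exact: measurable_funM.
have mGb1 i : G_measurable (b1 i) by exact: measurable_funM.
have mA1 : measurable_fun [set: T] A1 by exact: measurable_fun_sigma_sub mGA1.
have mk1 : measurable_fun [set: T] k1 by exact: measurable_fun_sigma_sub mGk1.
have mb1 i : measurable_fun [set: T] (b1 i) by exact: measurable_fun_sigma_sub (mGb1 i).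
have A1M w : 0 <= A1 w <= M.
  by rewrite /A1; have [[Dw ->]|[_ ->]] := ind w; rewrite ?mul1r ?mul0r ?lexx ?AM.
have k1M w : 0 <= k1 w <= M.
  by rewrite /k1; have [[Dw ->]|[_ ->]] := ind w; rewrite ?mul1r ?mul0r ?lexx ?kM.
have b1M i w : `|b1 i w| <= M.
  by rewrite /b1; have [[Dw ->]|[_ ->]] := ind w; rewrite ?mul1r ?mul0r ?normr0 ?bM.
have [iX kX] := cond_le_mul G_sub c0 mX X0 Xc mGk1 k1M.
have iA1 : integrable_fun A1.
  by apply: (integrable_bounded P mA1 (M := M)) => w; rewrite ger0_norm; case/andP: (A1M w).
have k1Mn w : `|k1 w| <= M by rewrite ger0_norm; case/andP: (k1M w).
have ik1X := integrable_bounded_mul mk1 k1Mn iX.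
have ik1c : integrable_fun (fun w => k1 w * c).
  exact: integrableZr (integrable_bounded P mk1 k1Mn).
have ibnu i : integrable_fun (fun w => b1 i w * nu w ord0 i).
  exact: integrable_bounded_mul (mb1 i) (b1M i) (nu0 i).1.
pose dn w := \sum_i b1 i w * nu w ord0 i.
have idn : integrable_fun dn.
  rewrite (_ : EFin \o dn = fun w => (\sum_i (b1 i w * nu w ord0 i)%:E)%E).
    by apply: integrable_sum => // i _; exact: ibnu.
  by apply/funext => w /=; rewrite sumEFin.
have dn0 : \int[P]_w dn w = 0.
  rewrite /Rintegral.
  under eq_integral do rewrite -sumEFin.
  rewrite integral_sum// big1// => i _.
  rewrite -(EFin_Rintegral measurableT (ibnu i)).
  by rewrite (cond_mean_zero_mul G_sub (nu0 i).1 (nu0 i).2 (mGb1 i) (b1M i)).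
have irhs1 : integrable_fun (fun w => A1 w + k1 w * X w) by exact: integrableD iA1 ik1X.
have irhs : integrable_fun (fun w => dn w + (A1 w + k1 w * X w)) by exact: integrableD idn irhs1.
have S1le w : S1 w + k1 w * c <= dn w + (A1 w + k1 w * X w).
  rewrite /S1 /k1 /A1 /dn /b1; have [[Dw ->]|[_ ->]] := ind w; last first.
    by rewrite big1 => [|i _]; rewrite !mul0r ?addr0.
  under eq_bigr do rewrite mul1r.
  by rewrite !mul1r; have := SA _ Dw; rewrite /dot; lra.
have S10 w : 0 <= S1 w.
  by rewrite /S1; have [[Dw ->]|[_ ->]] := ind w; rewrite ?mul1r ?mul0r.
have iS1 : integrable_fun S1.
  apply: le_integrable irhs => //; first by apply/measurable_EFinP; exact: measurable_funM.
  move=> w _ /=; rewrite lee_fin (ger0_norm (S10 w)); apply: le_trans (ler_norm _).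
  apply: le_trans (S1le w); rewrite lerDl mulr_ge0//.
  by case/andP: (k1M w).
rewrite !intD -!EFin_Rintegral// lee_fin.
have := le_Rintegral measurableT (integrableD measurableT iS1 ik1c) irhs (fun w _ => S1le w).
rewrite !RintegralD// dn0 => h; lra.
Qed.

End conditional_step.

(** * A maximal inequality for stopped supermartingales *)

Section maximal_inequality.
Context {d : measure_display} {T : measurableType d} {R : realType}.
Variables (P : probability T R) (S : nat -> T -> R) (a : R).
Hypotheses (a_gt0 : 0 < a) (mS : forall j, measurable_fun [set: T] (S j))
  (S_ge0 : forall j w, 0 <= S j w).

Definition stays_below (j : nat) : set T := [set w | forall i, (i <= j)%N -> S i w <= a].

Let le_set j : set T := [set w | S j w <= a].

Lemma measurable_le_set (U : T -> R) (b : R) :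
  measurable_fun [set: T] U -> measurable [set w | U w <= b].
Proof.
by move=> mU; rewrite -[X in measurable X]setTI; apply: measurable_fun_le.
Qed.

Lemma stays_belowS j : stays_below j.+1 = stays_below j `&` le_set j.+1.
Proof.
apply/seteqP; split => w /=.
  by move=> h; split; [move=> i ij; apply: h; exact: leqW|exact: h].
by move=> [h1 h2] i; rewrite leq_eqVlt ltnS => /predU1P[->//|]; exact: h1.
Qed.

Lemma stays_below0 : stays_below 0 = le_set 0.
Proof.
apply/seteqP; split => w /=; first exact.
by move=> h i; rewrite leqn0 => /eqP ->.
Qed.

Lemma measurable_stays_below j : measurable (stays_below j).
Proof.
elim: j => [|j IH]; first by rewrite stays_below0; exact: measurable_le_set.
by rewrite stays_belowS; apply: measurableI => //; exact: measurable_le_set.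
Qed.

(** Markov's inequality, applied only where [S j] exceeds [a]. *)
Lemma markov_restricted (D : set T) j : measurable D ->
  (a%:E * P (D `\` le_set j) + \int[P]_(w in D `&` le_set j) (S j w)%:E <=
   \int[P]_(w in D) (S j w)%:E)%E.
Proof.
move=> mD; have mB := measurable_le_set a (mS j).
have mD1 : measurable (D `\` le_set j) by exact: measurableD.
have mD2 : measurable (D `&` le_set j) by exact: measurableI.
have mSj E : measurable_fun E (fun w => (S j w)%:E).
  by apply: measurable_funTS; apply/measurable_EFinP.
rewrite -[X in (_ <= \int[P]_(w in X) _)%E](setUIDK D (le_set j)).
rewrite ge0_integral_setU//=; last 2 first.
- by move=> w _; rewrite lee_fin.
- by apply/disj_setPS => w [[_ ?] [_ ?]].
rewrite addeC leeD2l// -integral_cst//; apply: ge0_le_integral => //.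
- by move=> w _; rewrite lee_fin ltW.
- by move=> w [_ /negP]; rewrite -ltNge => h; rewrite /cst lee_fin ltW.
Qed.

Hypothesis step : forall j,
  (\int[P]_(w in stays_below j) (S j.+1 w)%:E <= \int[P]_(w in stays_below j) (S j w)%:E)%E.
Variable c : R.
Hypothesis init : (\int[P]_w (S 0 w)%:E <= c%:E)%E.

(** The left-hand side does not increase with [j]: by Markov's inequality, the
    mass that leaves the event costs at least [a] times its probability. *)
Lemma stopped_integral_le j :
  (a%:E * P (~` stays_below j) + \int[P]_(w in stays_below j) (S j w)%:E <= c%:E)%E.
Proof.
elim: j => [|j IH].
  have h := markov_restricted 0 measurableT.
  by rewrite setTD setTI -stays_below0 in h; exact: le_trans h init.
have mb := measurable_stays_below.
have -> : ~` stays_below j.+1 = ~` stays_below j `|` (stays_below j `\` le_set j.+1).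
  rewrite stays_belowS setCI; apply/seteqP; split=> w [nb|]; try by left.
    by move=> nl; have [bw|] := pselect (stays_below j w); [right|left].
  by move=> [_ nl]; right.
rewrite measureU//; last 3 first.
- exact: measurableC.
- by apply: measurableD => //; exact: measurable_le_set.
- by apply/seteqP; split => // w [? [? _]].
rewrite ge0_muleDr// -addeA stays_belowS; apply: le_trans IH; apply: leeD2l.
by apply: (le_trans (markov_restricted _ (mb j))); exact: step.
Qed.

Lemma stopped_maximal_inequality :
  ((1 - c / a)%:E <= P [set w | forall j, (S j w <= a)%R])%E.
Proof.
have -> : [set w | forall j, S j w <= a] = \bigcap_j stays_below j.
  apply/seteqP; split => w /=; first by move=> h j _ i _; exact: h.
  by move=> h j; exact: (h j I j (leqnn j)).
have mb := measurable_stays_below.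
have cvg_below : P (stays_below j) @[j --> \oo] --> P (\bigcap_j stays_below j).
  apply: nonincreasing_cvg_mu => //.
  - by rewrite (le_lt_trans (probability_le1 P _))// ltry.
  - exact: bigcapT_measurable.
  - apply/nonincreasing_seqP => j; rewrite stays_belowS; apply/subsetPset.
    exact: subIsetl.
apply: (cvge_to_ge cvg_below); apply: nearW => j.
have h : (a%:E * P (~` stays_below j) <= c%:E)%E.
  apply: le_trans (stopped_integral_le j); rewrite leeDl//.
  by apply: integral_ge0 => w _; rewrite lee_fin.
move: h; rewrite probability_setC//.
have /fineK <- : P (stays_below j) \is a fin_num by exact: fin_num_measure.
rewrite -EFinD -EFinM !lee_fin => h.
by rewrite lerBlDr -lerBlDl ler_pdivlMr// mulrC.
Qed.

End maximal_inequality.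

(** * Borel sets of row vectors *)

Section borel_rV.
Context {R : realType} {n : nat}.

Lemma continuous_measurable_rV (f : 'rV[R]_n -> R) : continuous f ->
  measurable_fun [set: borel_rV R n] (f : borel_rV R n -> R).
Proof.
move=> /continuousP cf; apply: (measurability _ (RGenOpens.measurableE R)).
move=> _ [_ [a [b ->] <-]]; rewrite setTI.
by apply: sub_sigma_algebra; apply: cf; exact: interval_open.
Qed.

Lemma measurable_coord (i : 'I_n) :
  measurable_fun [set: borel_rV R n] (fun v : borel_rV R n => (v : 'rV[R]_n) ord0 i).
Proof. by apply: continuous_measurable_rV => v; exact: coord_continuous. Qed.

(** There are countably many such cubes, and they exhaust every open set. *)
Definition rat_box (p : 'rV[rat]_n * nat) : set 'rV[R]_n :=
  [set v | forall i, `|ratr (p.1 ord0 i) - v ord0 i| <= p.2.+1%:R^-1].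

(** Inside a ball of radius [e], a cube of half-side below [e / 2] around a point
    close to the centre still fits. *)
Lemma open_bigcup_rat_box (U : set 'rV[R]_n) : open U ->
  U = \bigcup_(p in [set p | rat_box p `<=` U]) rat_box p.
Proof.
rewrite openE => oU; apply/seteqP; split => v; last by move=> [p]; exact.
move=> /oU /nbhs_ballP[e /= e0 eU].
have [m me] : exists m : nat, m.+1%:R^-1 < e / 2.
  have e2 : 0 < e / 2 by rewrite divr_gt0.
  exists (Num.truncn (e / 2)^-1).
  rewrite invf_plt ?posrE//; exact: truncnS_gt.
have m0 : 0 < m.+1%:R^-1 :> R by rewrite invr_gt0 ltr0n.
have approx (i : 'I_n) : exists q : rat, `|ratr q - v ord0 i| < m.+1%:R^-1.
  have [q /andP[q1 q2]] : exists q : rat, v ord0 i < ratr q < v ord0 i + m.+1%:R^-1.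
    have lt : v ord0 i < v ord0 i + m.+1%:R^-1 by rewrite ltrDl.
    have [q] := rat_in_itvoo lt; rewrite in_itv/= => h; by exists q.
  exists q; rewrite ltr_norml ltrBlDl q2 andbT.
  by apply: (@lt_trans _ _ 0); [rewrite oppr_lt0 | rewrite subr_gt0].
pose q := \row_i (sval (cid (approx i))).
exists (q, m) => /= [w wbox|i]; last by rewrite /q mxE; case: cid => r /= /ltW.
apply: eU; split => // i j; rewrite ord1.
have := wbox j; rewrite /= /q mxE; case: cid => r /= hr.
rewrite /ball /= => hw.
rewrite (_ : v ord0 j - w ord0 j = (ratr r - w ord0 j) - (ratr r - v ord0 j)); last by ring.
apply: (le_lt_trans (ler_normB _ _)); apply: (lt_trans (ler_ltD hw hr)).
by rewrite [ltRHS]splitr ltrD.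
Qed.

(** Every open set is a countable union of cubes, so that measurability of the
    coordinates is enough. *)
Lemma measurable_rV d (T : measurableType d) (X : T -> 'rV[R]_n) :
  (forall i, measurable_fun [set: T] (fun w => X w ord0 i)) ->
  measurable_fun [set: T] (X : T -> borel_rV R n).
Proof.
move=> mX; refine (@measurability _ _ T (borel_rV R n) setT X (@open _) erefl _).
move=> _ [U oU <-]; rewrite setTI (open_bigcup_rat_box oU) preimage_bigcup.
rewrite bigcup_mkcond; apply: countable_bigcupT_measurable => [//|p].
case: ifP => // _.
rewrite (_ : X @^-1` rat_box p =
  \bigcap_(i in [set: 'I_n]) [set w | `|ratr (p.1 ord0 i) - X w ord0 i| <= p.2.+1%:R^-1]).
  apply: fin_bigcap_measurable => // i _.
  rewrite -[X in measurable X]setTI.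
  apply: measurable_fun_le => //.
  by apply: measurableT_comp => //; apply: measurable_funB.
by apply/seteqP; split => w /= h i; [move=> _|]; exact: h.
Qed.

End borel_rV.

(** * Iterates, potential and high-probability bound *)

Section sgdm_process.
Context {R : realType} {n : nat} {d d' : measure_display}
  {T : measurableType d} {E : measurableType d'}.
Variables (P : probability T R) (xi : nat -> {RV P >-> E})
  (g : 'rV[R]_n -> E -> 'rV[R]_n) (x : nat -> T -> 'rV[R]_n) (x0 : 'rV[R]_n).

Definition noise_history (k : nat) : set_system T :=
  generators (fun i => xi i : T -> E) [set i | (1 <= i <= k)%N].

Notation F := noise_history.
Notation F_measurable k h :=
  (measurable_fun [set: g_sigma_algebraType (F k)] (h : g_sigma_algebraType (F k) -> _)).

Lemma noise_history_sub k : F k `<=` measurable.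
Proof.
move=> _ [i _ [B mB <-]]; rewrite setTI.
exact: measurable_funPTI.
Qed.

Lemma F_measurable_le dU (U : measurableType dU) (i j : nat) (h : T -> U) :
  (i <= j)%N -> F_measurable i h -> F_measurable j h.
Proof.
move=> ij mh _ Y mY.
have /= := mh measurableT Y mY; rewrite !setTI.
apply: sub_sigma_algebra2 => _ [k /= /andP[k1 ki] [B mB <-]].
exists k => /=; first by rewrite k1 (leq_trans ki).
by exists B.
Qed.

Lemma F_measurable_xi k : (1 <= k)%N -> F_measurable k (xi k).
Proof.
move=> k1 _ Y mY; apply: sub_sigma_algebra.
by exists k => /=; [rewrite k1 leqnn|exists Y].
Qed.

Variable s : nat -> R.
Hypotheses
  (mg : measurable_fun setT (fun p : (borel_rV R n * E)%type => g p.1 p.2 : borel_rV R n))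
  (x_0 : forall w, x 0 w = x0) (x_1 : forall w, x 1 w = x0)
  (x_rec : forall k w, (1 <= k)%N ->
    x k.+1 w = x k w + (k%:R / (k + 2)%:R) *: (x k w - x k.-1 w)
      - (2 * s k / (k + 2)%:R) *: g (x k w) (xi k w)).

Lemma measurable_dot dS (S : measurableType dS) (u v : S -> 'rV[R]_n) :
  (forall i, measurable_fun [set: S] (fun w => u w ord0 i)) ->
  (forall i, measurable_fun [set: S] (fun w => v w ord0 i)) ->
  measurable_fun [set: S] (fun w => dot (u w) (v w)).
Proof.
by move=> mu mv; apply: measurable_sum => i; exact: measurable_funM.
Qed.

Lemma F_measurable_coord k (h : T -> 'rV[R]_n) i :
  F_measurable k (h : T -> borel_rV R n) -> F_measurable k (fun w => h w ord0 i).
Proof. by move=> mh; exact: (measurableT_comp (measurable_coord i) mh). Qed.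

(** The iterate [x k.+1] only depends on the first [k] noise samples; the
    statement carries two consecutive iterates because the recursion does. *)
Lemma F_measurable_iterate k :
  F_measurable k (x k : T -> borel_rV R n) /\
  F_measurable k (x k.+1 : T -> borel_rV R n).
Proof.
elim: k => [|k [mk mk1]].
  rewrite (_ : x 0 = cst x0); last exact/funext.
  rewrite (_ : x 1 = cst x0); last exact/funext.
  by split; exact: measurable_cst.
have mk' := F_measurable_le (leqnSn k) mk.
have mk1' := F_measurable_le (leqnSn k) mk1.
split => //.
apply: (@measurable_rV R n _ (g_sigma_algebraType (F k.+1))) => i.
have mgx : F_measurable k.+1 ((fun w => g (x k.+1 w) (xi k.+1 w)) : T -> borel_rV R n).
  have mp : F_measurable k.+1 (fun w => (x k.+1 w, xi k.+1 w) : borel_rV R n * E).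
    by apply: measurable_fun_pair => //; exact: F_measurable_xi.
  exact: (measurableT_comp mg mp).
have mc := (F_measurable_coord i mk', F_measurable_coord i mk1', F_measurable_coord i mgx).
rewrite (_ : (fun w => _) = fun w => x k.+1 w ord0 i
    + (k.+1%:R / (k.+1 + 2)%:R) * (x k.+1 w ord0 i - x k w ord0 i)
    - (2 * s k.+1 / (k.+1 + 2)%:R) * g (x k.+1 w) (xi k.+1 w) ord0 i); last first.
  by apply/funext => w; rewrite x_rec// !mxE.
apply: measurable_funB; last by apply: measurable_funM => //; exact: mc.2.
apply: measurable_funD; first exact: mc.1.2.
apply: measurable_funM => //; apply: measurable_funB; [exact: mc.1.2|exact: mc.1.1].
Qed.

Variables (f : 'rV[R]_n -> R) (L sigma : R) (xstar : 'rV[R]_n).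
Hypotheses (L_gt0 : 0 < L) (sigma_gt0 : 0 < sigma)
  (f_convex : convex_function [set: convex_lmodType 'rV[R]_n] f)
  (f_smooth : lsmooth L f) (f_min : forall y, f xstar <= f y).
Hypotheses (s_gt0 : forall k, 0 < s k) (s_dec : forall k, s k.+1 <= s k)
  (s_le : forall k, 8 * L * s k <= 1)
  (s_sum : forall k, sigma ^+ 2 * \sum_(1 <= i < k) s i ^+ 2 <= 320^-1).

Definition extrapolated (j : nat) (w : T) : 'rV[R]_n :=
  x j.+1 w + j.+1%:R *: (x j.+1 w - x j w).

(** The step [s j] goes with [x j], while the distance is already that of the next
    extrapolated point: the potential of index [j] is known after [j] samples. *)
Definition potential (j : nat) (w : T) : R :=
  dot (extrapolated j w - xstar) (extrapolated j w - xstar)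
  + 4 * s j * j.+1%:R * (f (x j w) - f xstar).

Definition noise (j : nat) (w : T) : 'rV[R]_n :=
  g (x j.+1 w) (xi j.+1 w) - gradient f (x j.+1 w).

(** The part of the noise budget spent before step [j.+1]. *)
Definition step_energy (j : nat) : R := sigma ^+ 2 * \sum_(1 <= i < j.+1) s i ^+ 2.

Definition exp_potential (j : nat) (w : T) : R :=
  expR ((1 - 160 * step_energy j) * potential j w - 16 * step_energy j).

(** [lyapunov_step] produces the weight [s j.+1] on the previous gap, and the steps
    are nonincreasing. *)
Lemma potential_step j w :
  potential j.+1 w <= potential j w
    - 4 * s j.+1 * dot (noise j w) (extrapolated j w - xstar)
    + 8 * s j.+1 ^+ 2 * dot (noise j w) (noise j w).
Proof.
have h := lyapunov_step L_gt0 f_convex f_smooth f_min (s_gt0 j.+1) (s_le j.+1)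
  (x_rec w (ltn0Sn j)).
rewrite /= -/(extrapolated j w) -/(extrapolated j.+1 w) -/(noise j w) in h.
apply: (le_trans h); rewrite /potential 2!lerD2r lerD2l.
rewrite ler_wpM2r ?subr_ge0// ler_wpM2r ?ler0n//.
by rewrite ler_wpM2l.
Qed.

Lemma gap_le_potential j w :
  4 * s j * j.+1%:R * (f (x j w) - f xstar) <= potential j w.
Proof. by rewrite lerDr dot_ge0. Qed.

Lemma dist_le_potential j w :
  dot (extrapolated j w - xstar) (extrapolated j w - xstar) <= potential j w.
Proof.
rewrite lerDl; apply: mulr_ge0; last by rewrite subr_ge0.
by apply: mulr_ge0; [apply: mulr_ge0 => //; exact: ltW|exact: ler0n].
Qed.

Lemma step_energyS j :
  step_energy j.+1 = step_energy j + sigma ^+ 2 * s j.+1 ^+ 2.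
Proof. by rewrite /step_energy big_nat_recr//= mulrDr. Qed.

Lemma step_energy_bounds j : 0 <= step_energy j <= 320^-1.
Proof.
rewrite s_sum andbT mulr_ge0 ?sqr_ge0//.
by apply: sumr_ge0 => i _; rewrite sqr_ge0.
Qed.

Lemma F_measurable_coords j :
  (forall i, F_measurable j (fun w => x j w ord0 i)) /\
  (forall i, F_measurable j (fun w => (extrapolated j w - xstar) ord0 i)).
Proof.
have [mx mx1] := F_measurable_iterate j.
have mc i := F_measurable_coord i mx.
have mc1 i := F_measurable_coord i mx1.
split=> // i.
rewrite (_ : (fun w => _) = fun w => x j.+1 w ord0 i
  + j.+1%:R * (x j.+1 w ord0 i - x j w ord0 i) - xstar ord0 i); last first.
  by apply/funext => w; rewrite !mxE.
apply: measurable_funB => //; apply: measurable_funD => //.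
by apply: measurable_funM => //; apply: measurable_funB.
Qed.

Lemma F_measurable_potential j : F_measurable j (potential j).
Proof.
have [mx mz] := F_measurable_coords j.
apply: measurable_funD; first exact: (@measurable_dot _ (g_sigma_algebraType (F j))).
apply: measurable_funM => //; apply: measurable_funB => //.
have fc : continuous f.
  by move=> y; apply: differentiable_continuous; exact: f_smooth.1.
exact: (measurableT_comp (continuous_measurable_rV fc) (F_measurable_iterate j).1).
Qed.

Lemma F_measurable_measurable dU (U : measurableType dU) j (h : T -> U) :
  F_measurable j h -> measurable_fun [set: T] h.
Proof. exact: (measurable_fun_sigma_sub (@noise_history_sub j)). Qed.

Lemma F_measurable_exp_potential j : F_measurable j (exp_potential j).
Proof.
apply: measurableT_comp => //; apply: measurable_funB => //.
by apply: measurable_funM => //; exact: F_measurable_potential.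
Qed.

Hypotheses
  (noise_mean : forall j, cond_exp_vec_eq P (F j)
     (fun w => g (x j.+1 w) (xi j.+1 w)) (fun w => gradient f (x j.+1 w)))
  (noise_subgaussian : forall j, cond_exp_le P (F j)
     (fun w => expR (enorm (noise j w) ^+ 2 / sigma ^+ 2)) (fun=> expR 1)).

Lemma F_measurable_stays_below a j : <<s F j >> (stays_below exp_potential a j).
Proof.
have mle i : (i <= j)%N -> <<s F j >> [set w | exp_potential i w <= a].
  move=> ij.
  have mi := F_measurable_le ij (@F_measurable_exp_potential i).
  exact: (measurable_le_set a mi).
suff h i : (i <= j)%N -> <<s F j >> (stays_below exp_potential a i) by exact: h.
elim: i => [_|i IH ij]; first by rewrite stays_below0; exact: mle.
rewrite stays_belowS; apply: (@measurableI _ (g_sigma_algebraType (F j))); last exact: mle.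
exact: IH (ltnW ij).
Qed.

(** On this event the potential is bounded, hence so are the coefficients of the
    affine majorant given by [exp_potential_step]. *)
Lemma exp_potential_supermartingale a j : 0 <= a ->
  (\int[P]_(w in stays_below exp_potential a j) (exp_potential j.+1 w)%:E <=
   \int[P]_(w in stays_below exp_potential a j) (exp_potential j w)%:E)%E.
Proof.
move=> a0.
set e := sigma ^+ 2 * s j.+1 ^+ 2.
set lam := 1 - 160 * step_energy j.
have e0 : 0 <= e by rewrite mulr_ge0 ?sqr_ge0.
have /andP[Q0 Q1] := step_energy_bounds j.
have lamS : 1 - 160 * step_energy j.+1 = lam - 160 * e.
  by rewrite step_energyS -/e /lam; ring.
have eb : step_energy j + e <= 320^-1.
  by have /andP[_] := step_energy_bounds j.+1; rewrite step_energyS.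
have lb : 0 <= lam - 160 * e <= 1 by rewrite /lam; apply/andP; split; lra.
have eb32 : e <= 32^-1 by lra.
pose y w := extrapolated j w - xstar.
pose A w := exp_level (y w) (potential j w) lam e (step_energy j).
pose k w := exp_weight (y w) (potential j w) lam e (step_energy j).
pose b w := exp_slope (y w) (potential j w) lam e (s j.+1) (step_energy j).
have AS w : A w <= exp_potential j w by exact: exp_level_le (dist_le_potential j w) lb.
have mSj : measurable_fun [set: T] (exp_potential j).
  exact: F_measurable_measurable (@F_measurable_exp_potential j).
have mS1 : measurable_fun [set: T] (exp_potential j.+1).
  exact: F_measurable_measurable (@F_measurable_exp_potential j.+1).
have mD := @F_measurable_stays_below a j.
have mDT := sigma_sub (@noise_history_sub j) mD.
have [_ mz] := F_measurable_coords j.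
have mV := @F_measurable_potential j.
have mdot : F_measurable j (fun w => dot (y w) (y w)).
  exact: (@measurable_dot _ (g_sigma_algebraType (F j))).
have mbase : F_measurable j
    (fun w => expR ((lam - 160 * e) * potential j w - 16 * (step_energy j + e))).
  by apply: measurableT_comp => //; apply: measurable_funB => //; exact: measurable_funM.
have mA : F_measurable j A.
  apply: measurable_funM => //; apply: measurableT_comp => //.
  apply: measurable_funD => //; apply: measurable_funM => //.
  exact: measurable_funM.
have mk : F_measurable j k.
  apply: measurable_funM => //; apply: measurable_funM => //.
  apply: measurable_minr => //; apply: measurable_funD => //.
  by apply: measurable_funM => //; exact: measurable_funM.
have mb i : F_measurable j (fun w => b w ord0 i).
  rewrite (_ : (fun w => _) = fun w =>
    expR ((lam - 160 * e) * potential j w - 16 * (step_energy j + e)) *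
      (- (4 * (lam - 160 * e) * s j.+1) * y w ord0 i)); last first.
    by apply/funext => w; rewrite /b /exp_slope !mxE.
  by apply: measurable_funM => //; apply: measurable_funM => //; exact: mz.
have nu0 := cond_exp_vec_noise (@noise_history_sub j) (noise_mean j).
have mnu : measurable_fun [set: T] (fun w => dot (noise j w) (noise j w)).
  apply: measurable_dot => i; apply/measurable_EFinP; exact: measurable_int (nu0 i).1.
have mX : measurable_fun [set: T] (fun w => expR (dot (noise j w) (noise j w) / sigma ^+ 2)).
  by apply: measurableT_comp => //; exact: measurable_funM.
have Xc := cond_exp_le_cst (@noise_history_sub j) (expR_ge0 1) (noise_subgaussian j).
(* a common bound for the three coefficients on the event; the second part is the one
   for [b], obtained from [potential j <= 2 (a + 1)] *)
pose M := a + a * (4 * s j.+1 * (1 + 2 * (a + 1))).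
have sM : 0 <= a * (4 * s j.+1 * (1 + 2 * (a + 1))).
  by rewrite !mulr_ge0// ?(ltW (s_gt0 _))//; lra.
have aM : a <= M by rewrite lerDl.
have A0 w : 0 <= A w by rewrite mulr_ge0 ?expR_ge0.
have Sa w : stays_below exp_potential a j w -> exp_potential j w <= a by move=> h; exact: h.
have Ab w : stays_below exp_potential a j w -> 0 <= A w <= M.
  by move=> /Sa h; rewrite A0/=; exact: le_trans (AS w) (le_trans h aM).
apply: (@le_trans _ _ (\int[P]_(w in stays_below exp_potential a j) (A w)%:E)%E); last first.
  apply: ge0_le_integral => //.
  - by move=> w _; rewrite lee_fin.
  - apply: measurable_funTS; apply/measurable_EFinP; exact: F_measurable_measurable mA.
  - by apply: measurable_funTS; apply/measurable_EFinP.
  - by move=> w _; rewrite lee_fin.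
apply: (@supermartingale_step _ _ _ P (F j) (@noise_history_sub j) n _ _ A k
  (fun w => expR (dot (noise j w) (noise j w) / sigma ^+ 2)) b (noise j) (expR 1) M) => //.
- exact: le_trans aM.
- by move=> w; rewrite /exp_potential expR_ge0.
- by move=> B mB; under eq_integral => w _ do rewrite -enorm_sqr; exact: Xc.
- move=> w Dw; have /andP[k0 kA] : 0 <= k w <= A w by exact: exp_weight_bounds.
  by rewrite k0/=; apply: (le_trans kA); case/andP: (Ab _ Dw).
- move=> w i Dw.
  have h1 : expR ((lam - 160 * e) * potential j w - 16 * (step_energy j + e)) <= a.
    apply: le_trans (Sa _ Dw); apply: le_trans (AS w).
    exact: exp_base_le.
  rewrite /b /exp_slope mxE normrM (ger0_norm (expR_ge0 _)).
  have h2 : `|(- (4 * (lam - 160 * e) * s j.+1) *: y w) ord0 i| <=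
      4 * s j.+1 * (1 + 2 * (a + 1)).
    have Vge0 : 0 <= potential j w := le_trans (dot_ge0 _) (dist_le_potential j w).
    have Vle : potential j w <= 2 * (a + 1).
      (* [1 + t <= exp t], and the coefficient of the potential is at least [1 / 2] *)
      have := le_trans (expR_ge1Dx _) (Sa _ Dw).
      have l2 : 2^-1 <= 1 - 160 * step_energy j by lra.
      have := ler_wpM2r Vge0 l2; lra.
    have yi : `|y w ord0 i| <= 1 + 2 * (a + 1).
      have := le_trans (sqr_coord_le_dot (y w) i) (dist_le_potential j w).
      rewrite -[_ ^+ 2]real_normK ?num_real// => h.
      have := sqr_ge0 (`|y w ord0 i| - 1); lra.
    have /andP[l0 l1] := lb.
    have c0 : 0 <= 4 * (lam - 160 * e) * s j.+1.
      by apply: mulr_ge0; [apply: mulr_ge0|exact: ltW].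
    rewrite mxE normrM normrN (ger0_norm c0); apply: ler_pM => //.
    rewrite ler_wpM2r ?(ltW (s_gt0 _))//; lra.
  apply: (@le_trans _ _ (a * (4 * s j.+1 * (1 + 2 * (a + 1))))); last by rewrite lerDr.
  by apply: ler_pM; rewrite ?expR_ge0.
- move=> w _; rewrite /exp_potential lamS step_energyS -/e.
  apply: (exp_potential_step _ _ _ lb eb32) => //.
  exact: potential_step.
Qed.

Definition initial_potential : R :=
  dot (x0 - xstar) (x0 - xstar) + 4 * s 0 * (f x0 - f xstar).

Lemma potential0 w : potential 0 w = initial_potential.
Proof. by rewrite /potential /extrapolated x_1 x_0 subrr scaler0 addr0 mulr1. Qed.

Lemma exp_potential0 w : exp_potential 0 w = expR initial_potential.
Proof.
by rewrite /exp_potential potential0 /step_energy big_geq// !mulr0 !subr0 mul1r.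
Qed.

(** The maximal inequality at level [exp (V 0) / beta]; taking logarithms, the
    coefficient [1 - 160 Q] of the potential is at least [1 / 2]. *)
Lemma potential_high_probability beta : 0 < beta ->
  exists B : set T, [/\ measurable B, ((1 - beta)%:E <= P B)%E &
    forall w, B w -> forall j,
      potential j w <= 2 * (initial_potential + 1 + ln (1 / beta))].
Proof.
move=> b0; set a := expR (initial_potential) / beta.
have a0 : 0 < a by rewrite divr_gt0 ?expR_gt0.
have aE : a = expR (initial_potential + ln (1 / beta)).
  by rewrite expRD lnK ?posrE ?divr_gt0// div1r.
have mS j : measurable_fun [set: T] (exp_potential j).
  exact: F_measurable_measurable (@F_measurable_exp_potential j).
have S0 j w : 0 <= exp_potential j w by exact: expR_ge0.
exists [set w | forall j, exp_potential j w <= a]; split.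
- rewrite (_ : [set w | _] = \bigcap_j [set w | exp_potential j w <= a]).
    by apply: bigcapT_measurable => j; exact: measurable_le_set.
  by apply/seteqP; split => w /= h; [move=> j _; exact: h|move=> j; exact: h].
- have -> : beta = expR initial_potential / a.
    by rewrite /a invfM invrK mulrA mulfV ?mul1r// gt_eqF// expR_gt0.
  have init : (\int[P]_w (exp_potential 0 w)%:E <= (expR initial_potential)%:E)%E.
    under eq_integral => w _ do rewrite exp_potential0.
    rewrite integral_cst; last exact: measurableT.
    rewrite -[leRHS]mule1; apply: lee_wpmul2l; first by rewrite lee_fin expR_ge0.
    exact: probability_le1.
  have step j := exp_potential_supermartingale j (ltW a0).
  exact: (stopped_maximal_inequality a0 mS S0 step init).
- move=> w h j; have := h j; rewrite aE /exp_potential ler_expR => hj.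
  have /andP[Q0 Q1] := step_energy_bounds j.
  have Vge0 : 0 <= potential j w := le_trans (dot_ge0 _) (dist_le_potential j w).
  have l2 : 2^-1 <= 1 - 160 * step_energy j by lra.
  by have := ler_wpM2r Vge0 l2; lra.
Qed.

End sgdm_process.

(** * Anytime and stopping-time rates *)

(** Split according to the value of [tau]. *)
Lemma measurable_stopped {d : measure_display} {T : measurableType d} (tau : T -> nat)
    (A : nat -> set T) :
  (forall k, measurable [set w | (tau w <= k)%N]) -> (forall k, measurable (A k)) ->
  measurable [set w | A (tau w) w].
Proof.
move=> mtau mA.
have mlt k : measurable [set w | (tau w < k)%N].
  case: k => [|k]; last exact: mtau.
  by rewrite (_ : [set w | _] = set0)//; apply/seteqP; split.
rewrite (_ : [set w | A (tau w) w] = \bigcup_k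
    (([set w | (tau w <= k)%N] `\` [set w | (tau w < k)%N]) `&` A k)).
  by apply: bigcupT_measurable => k; apply: measurableI => //; exact: measurableD.
apply/seteqP; split => w /=.
  by move=> Aw; exists (tau w) => //; split => //; split=> /=; rewrite ?ltnn.
move=> [k _ [[/= le_k /negP ge_k]]]; rewrite -leqNgt in ge_k.
by have -> : tau w = k by apply/eqP; rewrite eqn_leq le_k.
Qed.

Theorem proposition1 (R : realType) (n : nat) (f : 'rV[R]_n -> R)
    (xstar : 'rV[R]_n) (L sigma : R)
    (L_gt0 : 0 < L) (sigma_gt0 : 0 < sigma)
    (f_convex : convex_function [set: convex_lmodType 'rV[R]_n] f)
    (f_smooth : lsmooth L f)
    (f_min : forall y, f xstar <= f y) :
  exists eta : R -> nat -> R,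
  (forall eps : R, 0 < eps < 1 / 2 -> forall k, (1 <= k)%N -> 0 < eta eps k) /\
  forall x0 : 'rV[R]_n,
  exists C0 : R,
  forall eps : R, 0 < eps < 1 / 2 ->
  forall (d d' : measure_display) (T : measurableType d) (E : measurableType d')
    (P : probability T R) (xi : nat -> {RV P >-> E})
    (g : 'rV[R]_n -> E -> 'rV[R]_n) (x : nat -> T -> 'rV[R]_n),
  let F := fun k : nat =>
    generators (fun i => xi i : T -> E) [set i | (1 <= i <= k)%N] in
  measurable_fun setT
    (fun p : (borel_rV R n * E)%type => g p.1 p.2 : borel_rV R n) ->
  sgdm_iterates x0 (eta eps) g (fun k => xi k : T -> E) x ->
  (forall k, (1 <= k)%N ->
    cond_exp_vec_eq P (F k.-1)
      (fun w => g (x k w) (xi k w))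
      (fun w => gradient f (x k w))) ->
  (forall k, (1 <= k)%N ->
    cond_exp_le P (F k.-1)
      (fun w => enorm (g (x k w) (xi k w)) ^+ 2)
      (fun w => enorm (gradient f (x k w)) ^+ 2 + sigma ^+ 2)) ->
  (forall k, (1 <= k)%N ->
    cond_exp_le P (F k.-1)
      (fun w => expR (enorm (g (x k w) (xi k w) - gradient f (x k w)) ^+ 2
                        / sigma ^+ 2))
      (fun _ => expR 1)) ->
  (forall beta : R, 0 < beta < 1 / 2 ->
    ((1 - 2 * beta)%:E <=
      P [set w | forall k, (1 <= k)%N ->
           (f (x k w) - f xstar <= C0 * sgdm_rate sigma eps beta k)%R])%E) /\
  (forall (beta : R) (tau : T -> nat), 0 < beta < 1 / 2 ->
    stopping_time x tau ->
    ((1 - 2 * beta)%:E <=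
      P [set w | (f (x (tau w) w) - f xstar
                    <= C0 * sgdm_rate sigma eps beta (tau w))%R])%E).
Proof.
(* [24 L c0 <= 1] gives [8 L s <= 1], as [s <= 3 c0]; [64 sigma c0 <= 1] bounds the
   noise budget [8 sigma^2 c0^2] by [1 / 320] *)
pose c0 := (24 * L + 64 * sigma)^-1.
have c0_gt0 : 0 < c0 by rewrite invr_gt0 addr_gt0// mulr_gt0.
have cL : 24 * L * c0 <= 1.
  by rewrite ler_pdivrMr ?mul1r ?lerDl ?mulr_ge0 ?(ltW sigma_gt0)// addr_gt0// mulr_gt0.
have csig : 64 * sigma * c0 <= 1.
  by rewrite ler_pdivrMr ?mul1r ?lerDr ?mulr_ge0 ?(ltW L_gt0)// addr_gt0// mulr_gt0.
exists (sgdm_eta c0); split.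
  move=> eps; rewrite div1r => eps_b k _; exact: sgdm_eta_gt0.
move=> x0.
(* an upper bound of the initial potential that does not depend on [eps] *)
pose V0 := dot (x0 - xstar) (x0 - xstar) + 4 * (3 * c0) * (f x0 - f xstar).
have V00 : 0 <= V0.
  by rewrite addr_ge0 ?dot_ge0// mulr_ge0 ?subr_ge0// !mulr_ge0// ltW.
exists ((V0 + 1) / (2 * c0)).
move=> eps; rewrite div1r => eps_b d d' T E P xi g x F mg [x_0 [x_1 x_rec]] gmean _ gsub.
pose s := sgdm_step c0 eps.
have s_gt0 k : 0 < s k by exact: sgdm_step_gt0.
have s_dec k : s k.+1 <= s k by exact: sgdm_step_nonincreasing.
have s_le k : 8 * L * s k <= 1.
  apply: le_trans cL; rewrite (_ : 24 * L * c0 = 8 * L * (3 * c0)); last by ring.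
  by rewrite ler_wpM2l ?mulr_ge0 ?(ltW L_gt0)// sgdm_step_le.
have s_sum k : sigma ^+ 2 * \sum_(1 <= i < k) s i ^+ 2 <= 320^-1.
  apply: (@le_trans _ _ (sigma ^+ 2 * (8 * c0 ^+ 2))).
    by rewrite ler_wpM2l ?sqr_ge0// sum_sqr_step.
  have : (64 * sigma * c0) ^+ 2 <= 1.
    by rewrite expr_le1// !mulr_ge0// ltW.
  lra.
have x_rec' k w : (1 <= k)%N ->
    x k.+1 w = x k w + (k%:R / (k + 2)%:R) *: (x k w - x k.-1 w)
      - (2 * s k / (k + 2)%:R) *: g (x k w) (xi k w).
  move=> k1; rewrite x_rec//; congr (_ - _ *: _).
  by rewrite /s sgdm_stepE// invfM; ring.
have mean j := gmean j.+1 (ltn0Sn j).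
have sub j := gsub j.+1 (ltn0Sn j).
have mx := F_measurable_iterate mg x_0 x_1 x_rec'.
have mxT k : measurable_fun [set: T] (x k : T -> borel_rV R n).
  exact: (F_measurable_measurable (mx k).1).
have fc : continuous f.
  by move=> y; apply: differentiable_continuous; exact: f_smooth.1.
have mgap k c : measurable [set w | f (x k w) - f xstar <= c].
  apply: measurable_le_set; apply: measurable_funB => //.
  exact: (measurableT_comp (continuous_measurable_rV fc) (mxT k)).
have bound beta : 0 < beta < 2^-1 -> exists B : set T,
    [/\ measurable B, ((1 - 2 * beta)%:E <= P B)%E & forall w, B w ->
      forall k, (1 <= k)%N -> f (x k w) - f xstar <=
        (V0 + 1) / (2 * c0) * sgdm_rate sigma eps beta k].
  move=> /andP[b0 b2].
  have [B [mB PB hB]] := potential_high_probability mg x_0 x_1 x_rec' L_gt0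
    sigma_gt0 f_convex f_smooth f_min s_gt0 s_dec s_le s_sum mean sub b0.
  exists B; split => //.
    by apply: le_trans PB; rewrite lee_fin; lra.
  move=> w Bw k k1.
  set l := ln (1 / beta).
  have l0 : 0 <= l by rewrite ln_ge0// div1r invf_ge1//; lra.
  have p0 : 0 < s k * k.+1%:R by rewrite mulr_gt0// ltr0n.
  have V : 4 * (s k * k.+1%:R) * (f (x k w) - f xstar) <= 2 * ((V0 + 1) * (1 + l)).
    rewrite mulrA; apply: (le_trans (gap_le_potential x s f xstar k w)).
    apply: (le_trans (hB w Bw k)); rewrite -/l ler_wpM2l//.
    have iV : initial_potential x0 s f xstar <= V0.
      rewrite /initial_potential lerD2l ler_wpM2r ?subr_ge0// ler_wpM2l//.
      exact: sgdm_step_le.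
    by have := mulr_ge0 V00 l0; lra.
  have V' : f (x k w) - f xstar <= (V0 + 1) / 2 * (1 + l) * (s k * k.+1%:R)^-1.
    by rewrite ler_pdivlMr//; lra.
  apply: (le_trans V').
  have eps0 : 0 < eps by case/andP: eps_b.
  have V1 : 0 <= (V0 + 1) / 2 * (1 + l) by rewrite mulr_ge0 ?divr_ge0 ?(addr_ge0 V00) ?(addr_ge0 ler01).
  apply: (le_trans (ler_wpM2l V1 (inv_step_le c0_gt0 eps_b k1))).
  have zh : zeta (1 + eps) ^+ 2 <= h_sigma sigma eps.
    rewrite /h_sigma ler_peMl ?sqr_ge0//; apply: le_trans (expR_ge1Dx _).
    by rewrite lerDl mulr_ge0 ?sqr_ge0// (le_trans ler01 (zeta_ge1 eps0)).
  rewrite /sgdm_rate -/l; set lp := ln (k + 2)%:R `^ _; set q := (Num.sqrt (k + 1)%:R)^-1.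
  have lpq : 0 <= lp * q by rewrite mulr_ge0 ?powR_ge0// invr_ge0 sqrtr_ge0.
  rewrite (_ : _ * (c0^-1 * _ * lp * q) =
    (V0 + 1) / (2 * c0) * (1 + l) * (lp * q) * zeta (1 + eps) ^+ 2); last first.
    by field; rewrite gt_eqF.
  rewrite (_ : _ * (h_sigma sigma eps * (1 + l) * lp * q) =
    (V0 + 1) / (2 * c0) * (1 + l) * (lp * q) * h_sigma sigma eps); last by ring.
  have C00 : 0 <= (V0 + 1) / (2 * c0).
    by apply: divr_ge0; [exact: addr_ge0|apply: mulr_ge0 => //; exact: ltW].
  by rewrite ler_wpM2l// mulr_ge0// mulr_ge0// addr_ge0.
split.
  move=> beta b01; have [B [mB PB hB]] := bound _ b01.
  apply: (le_trans PB); apply: le_measure; rewrite ?inE//.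
    rewrite (_ : [set w | _] = \bigcap_(k in [set k | (1 <= k)%N])
      [set w | f (x k w) - f xstar <= (V0 + 1) / (2 * c0) * sgdm_rate sigma eps beta k]).
      by apply: bigcap_measurableType => k _.
    by apply/seteqP; split => w /= h k; exact: h.
move=> beta tau b01 [tau1 mtau]; have [B [mB PB hB]] := bound _ b01.
apply: (le_trans PB); apply: le_measure; rewrite ?inE//.
  apply: (@measurable_stopped _ _ tau (fun k =>
    [set w | f (x k w) - f xstar <= (V0 + 1) / (2 * c0) * sgdm_rate sigma eps beta k])) => //.
  move=> k; apply: (sigma_sub _ (mtau k)) => _ [i _ [C mC <-]].
  exact: (mxT i measurableT C mC).
by move=> w Bw; apply: hB.
Qed.
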